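(* Consider the following evolution model. Let $X$ and $Z$ be positive integer-valued random variables; let $(X_n)_{n\ge 0}$ be i.i.d.\ copies of $X$, $(Z_n)_{n\ge 0}$ i.i.d.\ copies of $Z$, all mutually independent. Fix $p\in(0,1)$ and set $q=1-p$. The state at time $n$ is a finite set $T_n$ of vertices, each carrying a fitness in $[0,1]$, with $T_0=\emptyset$. At each time $n$, independently of everything else: with probability $p$, $Z_n$ new vertices are added, each with a fitness uniformly distributed on $[0,1]$ independently of each other and of everything else (so $|T_{n+1}|=|T_n|+Z_n$); otherwise (with probability $q$) the $X_n$ vertices with the smallest fitnesses are removed, and if $T_n$ has fewer than $X_n$ vertices all are removed (so $|T_{n+1}|=\max\{|T_n|-X_n,0\}$). Let $\mu_X=\mathbb{E}X$, $\mu_Z=\mathbb{E}Z$ (possibly infinite), and when both are finite let $p_c=\frac{\mu_X}{\mu_X+\mu_Z}$. Then: (a) If $\mu_Z=\infty$ and $\mu_X<\infty$, then $T_n$ (as a set of fitnesses) approaches a random sample from $U[0,1]$. (b) If $\mu_Z<\infty$, $\mu_X<\infty$ and $p>p_c$, then $T_n$ approaches a random sample from $U[f,1]$, where $f=\frac{q}{p}\frac{\mu_X}{\mu_Z}$. (c) If $\mu_Z<\infty$ and either ($\mu_X<\infty$ and $p<p_c$) or $\mu_X=\infty$, then almost surely $T_n=\emptyset$ for infinitely many $n$.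
   Context: Definition: Suppose $A_1\subseteq A_2\subseteq\cdots$ is an infinite sequence of sets, each a finite collection of points in $\mathbb{R}$. We say $A_n$ approaches a random sample from distribution $F$ if, with probability $1$, there exists another sequence of sets $B_1\subseteq B_2\subseteq\cdots$ such that (i) each $B_n$ is a finite collection of i.i.d.\ random variables with common distribution $F$; (ii) $|B_n|\to\infty$ as $n\to\infty$; (iii) $|A_n\,\Delta\, B_n|=o(|B_n|)$ as $n\to\infty$, where $A\Delta B=(A\setminus B)\cup(B\setminus A)$. $U[a,b]$ denotes the uniform distribution on $[a,b]$. *)

(* Defs.v *)
From HB Require Import structures.
From mathcomp Require Import all_boot all_order all_algebra.
From mathcomp Require Import all_classical all_reals all_analysis.
Set Implicit Arguments. Unset Strict Implicit. Unset Printing Implicit Defensive.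
Import Order.TTheory GRing.Theory Num.Theory.
Import numFieldNormedType.Exports.
Local Open Scope classical_set_scope.
Local Open Scope ring_scope.

Section defs.
Context {R : realType} {d : measure_display} {T : measurableType d}.

Definition mutually_independent (P : probability T R) {I : eqType}
    (V : I -> T -> R) : Prop :=
  (forall i, measurable_fun setT (V i)) /\
  forall (J : seq I) (A : I -> set R), uniq J ->
    (forall i, measurable (A i)) ->
    fine (P (\bigcap_(i in [set` J]) (V i @^-1` A i))) =
    \prod_(i <- J) fine (P (V i @^-1` A i)).

Definition has_law (P : probability T R) (Y : T -> R)
    (law : set R -> \bar R) : Prop :=
  measurable_fun setT Y /\
  forall A : set R, measurable A -> P (Y @^-1` A) = law A.

Definition mean (P : probability T R) (V : T -> nat) : \bar R :=
  (\int[P]_w ((V w)%:R)%:E)%E.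
End defs.

Definition unif {R : realType} (a b : R) (A : set R) : \bar R :=
  (((b - a)^-1)%:E * (@lebesgue_measure R) (A `&` `[a, b]))%E.

(* finite collections of points are represented by sequences, read as sets *)
Definition card_set {R : realType} (A : seq R) : nat := size (undup A).
Definition card_symdiff {R : realType} (A B : seq R) : nat :=
  size (undup [seq x <- A | x \notin B]) + size (undup [seq x <- B | x \notin A]).

(* "A_n approaches a random sample from law": there are i.i.d. random
   variables Y_0, Y_1, ... with common law [law] such that a.s. there is a
   nondecreasing N_n with B_n = {Y_0,...,Y_(N_n - 1)} (so B_n is nested),
   |B_n| -> oo and |A_n Delta B_n| = o(|B_n|). *)
Definition approaches {R : realType} {d : measure_display} {T : measurableType d}
    (P : probability T R) (A : nat -> T -> seq R) (law : set R -> \bar R) : Prop :=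
  exists Y : nat -> T -> R,
    mutually_independent P Y /\ (forall i, has_law P (Y i) law) /\
    {ae P, forall w, exists N : nat -> nat,
       (forall n, (N n <= N n.+1)%N) /\
       (forall M : nat, exists n0, forall n, (n0 <= n)%N ->
          (M <= card_set (mkseq (Y^~ w) (N n)))%N) /\
       (forall e : R, 0 < e -> \forall n \near \oo,
          ((card_symdiff (A n w) (mkseq (Y^~ w) (N n)))%:R
             <= e * (card_set (mkseq (Y^~ w) (N n)))%:R))}.

(* the sources of randomness of the model, as one family of real r.v.'s *)
Inductive src := SB of nat | SX of nat | SZ of nat | SU of nat & nat.

Definition src_eq_dec (a b : src) : {a = b} + {a <> b}.
Proof. decide equality; exact: (decP eqP). Defined.
HB.instance Definition _ := hasDecEq.Build src (compareP src_eq_dec).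

Definition sources {R : realType} {T : Type} (B : nat -> T -> bool)
  (X Z : nat -> T -> nat) (U : nat -> nat -> T -> R) (i : src) : T -> R :=
  match i with
  | SB n => fun w => ((B n w : nat)%:R)
  | SX n => fun w => ((X n w)%:R)
  | SZ n => fun w => ((Z n w)%:R)
  | SU n k => U n k
  end.

Definition step {R : realType} (s : seq R) (b : bool) (x z : nat)
    (u : nat -> R) : seq R :=
  if b then s ++ mkseq u z else drop x (sort <=%R s).

Fixpoint state {R : realType} {T : Type} (B : nat -> T -> bool)
  (X Z : nat -> T -> nat) (U : nat -> nat -> T -> R) (n : nat) (w : T)
  : seq R :=
  match n with
  | 0 => [::]
  | n'.+1 => step (state B X Z U n' w) (B n' w) (X n' w) (Z n' w)
                  (fun k => U n' k w)
  end.

(* Main.v *)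
Require Import Defs.
From HB Require Import structures.
From mathcomp Require Import all_boot all_order all_algebra.
From mathcomp Require Import all_classical all_reals all_analysis.
From mathcomp Require Import measurable_realfun.
From mathcomp Require Import ring lra zify.
Import Order.TTheory GRing.Theory Num.Theory.
Import numFieldNormedType.Exports.
Local Open Scope classical_set_scope.
Local Open Scope ring_scope.
Set Implicit Arguments. Unset Strict Implicit. Unset Printing Implicit Defensive.

(** A Lindley-type argument. Let [l n] count the vertices of the state with fitness at most [f].
    As removals always take the smallest fitnesses, [l] is a walk reflected at zero, with steps
    "births at most [f]" minus "requested removals", so [l n = S n - S k] for some [k <= n],
    where [S] is the free walk. For [f = (q/p) (muX/muZ)] the walk has zero drift and the strong
    law gives [l n = o(n)]; hence almost all removals hit births at most [f] and only [o(n)] of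
    the births above [f] are ever removed. The births above [f], listed in order of appearance,
    are i.i.d. uniform on [[f, 1]]. The case of infinite [muZ] is the same with [f = 0], and in
    the subcritical case the size of the state is a reflected walk with negative drift.

    The strong law is needed for nonnegative integer variables only: bounded variables are
    handled by Chebyshev's inequality along squares, and the unbounded remainder, of small mean,
    by a crude dyadic truncation bound. *)

(** * Integer-valued random variables *)

Section nat_valued_random_variables.
Context {R : realType} {d : measure_display} {T : measurableType d}.
Variable P : probability T R.
Implicit Types (W : T -> nat) (S : set nat).

Definition nat_measurable W := forall S, measurable (W @^-1` S).

Lemma measurable_fun_nat W (g : nat -> \bar R) :
  nat_measurable W -> measurable_fun setT (fun w => g (W w)).
Proof. by move=> mW _ Y mY; rewrite setTI; exact: (mW (g @^-1` Y)). Qed.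

Lemma nat_measurable_singl W :
  (forall k, measurable [set w | W w = k]) -> nat_measurable W.
Proof.
move=> mW S.
rewrite (_ : W @^-1` S = \bigcup_(k in S) [set w | W w = k]).
  by apply: bigcup_measurable => k _.
by apply/seteqP; split=> [w Sw|w [k Sk /= ->]//]; exists (W w).
Qed.

Lemma nat_measurable_comp (g : nat -> nat) W :
  nat_measurable W -> nat_measurable (fun w => g (W w)).
Proof. by move=> mW S; exact: (mW (g @^-1` S)). Qed.

Lemma nat_measurable_op W W' (h : nat -> nat -> nat) :
  nat_measurable W -> nat_measurable W' ->
  nat_measurable (fun w => h (W w) (W' w)).
Proof.
move=> mW mW' S.
rewrite (_ : _ @^-1` S =
    \bigcup_a (W @^-1` [set a] `&` W' @^-1` [set b | S (h a b)])).
  by apply: bigcup_measurable => a _; apply: measurableI.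
apply/seteqP; split=> [w Sw|w [a _ [/= <-]//]].
by exists (W w).
Qed.

Lemma nat_measurable_cst k : nat_measurable (fun=> k).
Proof.
by apply: nat_measurable_singl => j; have [->|jk] := eqVneq k j;
  [rewrite (_ : [set _ | _] = setT)//; apply/seteqP; split|
   rewrite (_ : [set _ | _] = set0)//; apply/seteqP; split=> //= w /eqP; rewrite (negbTE jk)].
Qed.

Lemma nat_measurable_bool (E : set T) (b : T -> bool) :
  measurable E -> (forall w, b w <-> E w) -> nat_measurable (fun w => b w : nat).
Proof.
move=> mE bE; apply: nat_measurable_singl => k.
have -> : [set w | (b w : nat) = k] =
    if k == 0%N then ~` E else if k == 1%N then E else set0.
  apply/seteqP; split=> w /=.
    case bw: (b w) => /= <- /=; first exact/bE.
    by move/bE; rewrite bw.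
  case: k => [|[|k]] //=.
    by case bw: (b w) => //=; have := (bE w).1 bw.
  by move/bE ->.
by case: k => [|[|k]] //=; exact: measurableC.
Qed.

Lemma nat_measurable_sum (W : nat -> T -> nat) n :
  (forall i, nat_measurable (W i)) ->
  nat_measurable (fun w => \sum_(i < n) W i w)%N.
Proof.
move=> mW; elim: n => [|n IHn].
  by under eq_fun do rewrite big_ord0; exact: nat_measurable_cst.
under eq_fun do rewrite big_ord_recr /=.
exact: (@nat_measurable_op _ _ addn).
Qed.

Lemma mean_ge0 W : (0 <= mean P W)%E.
Proof. by apply: integral_ge0 => w _; rewrite lee_fin. Qed.

Lemma meanD W W' : nat_measurable W -> nat_measurable W' ->
  mean P (fun w => W w + W' w)%N = (mean P W + mean P W')%E.
Proof.
move=> mW mW'; rewrite /mean -ge0_integralD//.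
- by apply: eq_integral => w _; rewrite natrD.
- exact: (@measurable_fun_nat _ (fun k => k%:R%:E)).
- exact: (@measurable_fun_nat _ (fun k => k%:R%:E)).
Qed.

Lemma mean_sum (W : nat -> T -> nat) n :
  (forall i, nat_measurable (W i)) ->
  mean P (fun w => \sum_(i < n) W i w)%N = (\sum_(i < n) mean P (W i))%E.
Proof.
move=> mW; elim: n => [|n IHn].
  under eq_fun do rewrite big_ord0.
  by rewrite big_ord0 /mean integral0.
under eq_fun do rewrite big_ord_recr /=.
by rewrite meanD ?IHn ?big_ord_recr//; exact: nat_measurable_sum.
Qed.

Lemma mean_le W W' : nat_measurable W -> nat_measurable W' ->
  (forall w, W w <= W' w)%N -> (mean P W <= mean P W')%E.
Proof.
move=> mW mW' WW'; apply: ge0_le_integral => //.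
- exact: (@measurable_fun_nat _ (fun k => k%:R%:E)).
- exact: (@measurable_fun_nat _ (fun k => k%:R%:E)).
- by move=> w _; rewrite lee_fin ler_nat.
Qed.

Lemma mean_bool (E : set T) (b : T -> bool) :
  measurable E -> (forall w, b w <-> E w) -> mean P (fun w => b w : nat) = P E.
Proof.
move=> mE bE; rewrite -[P E]/(P E) -(setIT E) -integral_indic//.
apply: eq_integral => w _; rewrite indicE; congr (_%:R%:E).
by congr nat_of_bool; apply/idP/idP => [/bE|]; rewrite inE// => /bE.
Qed.

Lemma mean_cvg (W_ : nat -> T -> nat) W :
  (forall M, nat_measurable (W_ M)) ->
  (forall M w, W_ M w <= W_ M.+1 w)%N ->
  (forall w, exists N, forall M, (N <= M)%N -> W_ M w = W w) ->
  mean P (W_ M) @[M --> \oo] --> mean P W.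
Proof.
move=> mW ndW WW.
have nd w : {homo (fun M => W_ M w) : m n / (m <= n)%N >-> (m <= n)%N}.
  by apply: homo_leq => //; exact: leq_trans.
have -> : mean P W = (\int[P]_w limn (fun M => (W_ M w)%:R%:E))%E.
  apply: eq_integral => w _; apply/esym/cvg_lim => //.
  have [N WN] := WW w.
  apply: cvg_near_cst; near=> M; rewrite WN//.
  by near: M; exists N.
apply: (@cvg_monotone_convergence _ _ _ P _ measurableT
   (fun M w => (W_ M w)%:R%:E)) => //.
- by move=> n; exact: (@measurable_fun_nat _ (fun k => k%:R%:E)).
- by move=> x _ m n mn; rewrite lee_fin ler_nat; exact: nd.
Unshelve. all: by end_near. Qed.

Lemma minn_sum_ltn k M : minn k M = (\sum_(i < M) (i < k))%N.
Proof.
elim: M => [|M IH]; first by rewrite big_ord0 minn0.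
rewrite big_ord_recr /= -IH; lia.
Qed.

Lemma mean_minn W M : nat_measurable W ->
  mean P (fun w => minn (W w) M) = (\sum_(k < M) P (W @^-1` [set j | (k < j)%N]))%E.
Proof.
move=> mW; under eq_fun do rewrite minn_sum_ltn.
rewrite (@mean_sum (fun i w => (i < W w)%N : nat)).
  apply: eq_bigr => i _; exact: mean_bool.
move=> i; exact: (@nat_measurable_bool (W @^-1` [set j | (i < j)%N])).
Qed.

Lemma mean_minn_cvg W : nat_measurable W ->
  mean P (fun w => minn (W w) M) @[M --> \oo] --> mean P W.
Proof.
move=> mW; apply: mean_cvg => [M|M w|w].
- by apply: (@nat_measurable_op W (fun=> M)) => //; exact: nat_measurable_cst.
- lia.
- by exists (W w) => M; lia.
Qed.

Lemma mean_tail_cvg W : nat_measurable W ->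
  (\sum_(k < M) P (W @^-1` [set j | (k < j)%N]))%E @[M --> \oo] --> mean P W.
Proof.
move=> mW; under eq_fun do rewrite -mean_minn//.
exact: mean_minn_cvg.
Qed.

Lemma mean_eq_law W W' : nat_measurable W -> nat_measurable W' ->
  (forall S, P (W @^-1` S) = P (W' @^-1` S)) -> mean P W = mean P W'.
Proof.
move=> mW mW' WW'.
have := @mean_tail_cvg W mW; under eq_fun do under eq_bigr do rewrite WW'.
move=> /cvg_lim <- //; have /cvg_lim <- // := @mean_tail_cvg W' mW'.
Qed.

Lemma eq_law_singl W W' : nat_measurable W -> nat_measurable W' ->
  (forall k, P [set w | W w = k] = P [set w | W' w = k]) ->
  forall S, P (W @^-1` S) = P (W' @^-1` S).
Proof.
move=> mW mW' WW' S.
have H V : nat_measurable V ->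
    P (V @^-1` S) = (\sum_(0 <= k <oo | k \in S) P [set w | V w = k])%E.
  move=> mV; rewrite -measure_bigcup//.
  - by congr (P _); apply/seteqP; split=> [w Sw|w [k Sk /= ->]//]; exists (V w).
  - by move=> i _; exact: (mV [set i]).
  - by apply/trivIsetP => i j _ _ ij; rewrite -subset0 => w [/= -> /eqP]; rewrite (negbTE ij).
by rewrite !H//; apply: eq_eseriesr => k _.
Qed.

End nat_valued_random_variables.

(** * The strong law of large numbers *)

Section law_of_large_numbers.
Context {R : realType} {d : measure_display} {T : measurableType d}.
Variable P : probability T R.
Implicit Types (V : nat -> T -> nat) (S : set nat).

Lemma borel_cantelli_ae (E : nat -> set T) (a : nat -> R) (C : R) :
  (forall k, measurable (E k)) -> (forall k, P (E k) <= (a k)%:E)%E ->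
  (forall N, \sum_(k < N) a k <= C) ->
  {ae P, forall w, \forall k \near \oo, ~ E k w}.
Proof.
move=> mE Ea aC.
have mlim : measurable (lim_sup_set E).
  by apply: bigcap_measurable => // k _; exact: bigcup_measurable.
exists (lim_sup_set E); split => //.
  apply: lim_sup_set_cvg0 => //.
  apply: (@le_lt_trans _ _ C%:E); last by rewrite ltry.
  apply: lime_le; first exact: is_cvg_nneseries.
  apply: nearW => N; rewrite big_mkord.
  apply: (@le_trans _ _ (\sum_(k < N) (a k)%:E)%E); first by apply: lee_sum => k _; exact: Ea.
  by rewrite sumEFin lee_fin.
move=> w /= nE n _ /=; apply: contrapT => nEn; apply: nE.
exists n => // k /= nk Ekw; apply: nEn; by exists k.
Qed.

Lemma probE (E : set T) : measurable E -> P E = (fine (P E))%:E.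
Proof. by move=> mE; apply/esym; apply: fineK; exact: fin_num_measure. Qed.

Lemma prob_bigcup (F : nat -> set T) : (forall i, measurable (F i)) ->
  trivIset setT F -> P (\bigcup_i F i) = (\sum_(0 <= i <oo) P (F i))%E.
Proof.
by move=> mF tF; apply: measure_semi_bigcup => //; exact: bigcup_measurable.
Qed.

Definition pairwise_iid V := [/\ forall i, nat_measurable (V i),
  forall i j S S', i != j ->
    P (V i @^-1` S `&` V j @^-1` S') = (P (V i @^-1` S) * P (V j @^-1` S'))%E &
  forall i S, P (V i @^-1` S) = P (V 0%N @^-1` S)].

Lemma pairwise_iid_comp (g : nat -> nat) V :
  pairwise_iid V -> pairwise_iid (fun i w => g (V i w)).
Proof.
move=> [mV iV eV]; split=> [i S|i j S S'|i S].
- exact: (mV i (g @^-1` S)).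
- exact: (iV i j (g @^-1` S) (g @^-1` S')).
- exact: (eV i (g @^-1` S)).
Qed.

Lemma pairwise_iid_mean V i : pairwise_iid V -> mean P (V i) = mean P (V 0%N).
Proof. by move=> [mV _ eV]; exact: mean_eq_law. Qed.

Lemma mean_cst k : mean P (fun=> k) = k%:R%:E.
Proof. by rewrite /mean integral_cst// [X in (_ * X)%E]probability_setT mule1. Qed.

Definition partial_sum V n w := (\sum_(i < n) V i w)%N.

Section bounded.
Variables (V : nat -> T -> nat) (K : nat).
Hypotheses (iidV : pairwise_iid V) (VK : forall i w, (V i w <= K)%N).
Let m := fine (mean P (V 0%N)).
Let s2 := fine (mean P (fun w => V 0%N w ^ 2)%N).

Let mV i : nat_measurable (V i). Proof. by case: iidV. Qed.

Let meanE W k : nat_measurable W -> (forall w, W w <= k)%N ->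
  mean P W = (fine (mean P W))%:E.
Proof.
move=> mW Wk; rewrite fineK// ge0_fin_numE ?mean_ge0//.
rewrite (le_lt_trans (mean_le _ mW (nat_measurable_cst k) Wk))//.
by rewrite mean_cst ltry.
Qed.

Let meanV i : mean P (V i) = m%:E.
Proof. by rewrite pairwise_iid_mean// (meanE _ (@VK 0%N)). Qed.

Let meanV2 i : mean P (fun w => V i w ^ 2)%N = s2%:E.
Proof.
have iid2 := pairwise_iid_comp (fun k => k ^ 2)%N iidV.
rewrite (pairwise_iid_mean i iid2) (@meanE _ (K ^ 2)%N)//.
  by case: iid2.
by move=> w; rewrite leq_sqr.
Qed.

Let meanVV i j : i != j -> mean P (fun w => V i w * V j w)%N = (m * m)%:E.
Proof.
move=> ij.
have Vmin l w : V l w = (\sum_(a < K) (a < V l w))%N.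
  by rewrite -minn_sum_ltn; apply/esym/minn_idPl.
pose q (a : nat) := fine (P (V 0%N @^-1` [set k | (a < k)%N])).
have mE l (a : nat) : measurable (V l @^-1` [set k | (a < k)%N]) by exact: mV.
have mq : m = \sum_(a < K) q a.
  apply: EFin_inj; rewrite -(meanV 0%N) -sumEFin.
  under eq_bigr do rewrite /q -probE//.
  rewrite -mean_minn//; congr mean; apply/funext => w.
  by apply/esym/minn_idPl.
have -> : (fun w => V i w * V j w)%N =
    (fun w => \sum_(a < K) \sum_(b < K) ((a < V i w) && (b < V j w)))%N.
  apply/funext => w; rewrite [in LHS](Vmin i) [in LHS](Vmin j) big_distrlr /=.
  by apply: eq_bigr => a _; apply: eq_bigr => b _; rewrite mulnb.
have mEE a b : measurable (V i @^-1` [set k | (a < k)%N] `&`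
                           V j @^-1` [set k | (b < k)%N]).
  exact: measurableI.
have bE a b w : ((a < V i w) && (b < V j w))%N <->
    (V i @^-1` [set k | (a < k)%N] `&` V j @^-1` [set k | (b < k)%N]) w.
  by split=> [/andP[? ?]|[/= -> ->]//]; split.
have mb a b : nat_measurable (fun w => (a < V i w) && (b < V j w) : nat)%N.
  exact: (nat_measurable_bool (mEE a b)).
rewrite (mean_sum P (W := fun a w => \sum_(b < K) ((a < V i w) && (b < V j w)))%N).
  under eq_bigr => a _.
    rewrite (mean_sum P (W := fun b w => ((a < V i w) && (b < V j w)) : nat)%N)//.
    under eq_bigr => b _.
      rewrite (mean_bool P (mEE a b) (bE a b)).
      case: iidV => _ indV eV; rewrite indV// eV [X in (_ * X)%E]eV.
      rewrite (probE (mE 0%N a)) (probE (mE 0%N b)) -EFinM.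
      over.
    rewrite sumEFin; over.
  by rewrite sumEFin mq big_distrlr.
by move=> a; exact: (@nat_measurable_sum _ _ (fun b w => ((a < V i w) && (b < V j w)) : nat)%N).
Qed.

Let mS n : nat_measurable (partial_sum V n).
Proof. exact: nat_measurable_sum. Qed.

Let meanS n : mean P (partial_sum V n) = (n%:R * m)%:E.
Proof.
rewrite /partial_sum mean_sum//.
under eq_bigr do rewrite meanV.
by rewrite sumEFin sumr_const card_ord mulr_natl.
Qed.

Let meanSV n : mean P (fun w => partial_sum V n w * V n w)%N = (n%:R * (m * m))%:E.
Proof.
have -> : (fun w => partial_sum V n w * V n w)%N =
          (fun w => \sum_(i < n) V i w * V n w)%N.
  by apply/funext => w; rewrite /partial_sum big_distrl.
rewrite (mean_sum P (W := fun i w => V i w * V n w)%N); last first.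
  by move=> i; exact: (nat_measurable_op muln).
under eq_bigr => i _ do rewrite meanVV ?neq_ltn ?ltn_ord//.
by rewrite sumEFin sumr_const card_ord mulr_natl.
Qed.

Let meanS2 n : mean P (fun w => partial_sum V n w ^ 2)%N =
  (n%:R * n%:R * (m * m) + n%:R * (s2 - m * m))%:E.
Proof.
elim: n => [|n IHn].
  rewrite /partial_sum; under eq_fun do rewrite big_ord0.
  by rewrite mean_cst !mul0r addr0.
have -> : (fun w => partial_sum V n.+1 w ^ 2)%N =
  (fun w => partial_sum V n w ^ 2 + (partial_sum V n w * V n w +
            (partial_sum V n w * V n w + V n w ^ 2)))%N.
  apply/funext => w; rewrite /partial_sum big_ord_recr /=; ring.
have mSV : nat_measurable (fun w => partial_sum V n w * V n w)%N.
  exact: (nat_measurable_op muln).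
have mV2 : nat_measurable (fun w => V n w ^ 2)%N.
  exact: (nat_measurable_comp (fun a => a ^ 2)%N).
have mS2 : nat_measurable (fun w => partial_sum V n w ^ 2)%N.
  exact: (nat_measurable_comp (fun a => a ^ 2)%N).
have mSVV : nat_measurable (fun w => partial_sum V n w * V n w + V n w ^ 2)%N.
  exact: (nat_measurable_op addn).
rewrite !meanD//; last exact: (nat_measurable_op addn).
rewrite IHn meanSV meanV2 -!EFinD; congr EFin; rewrite -natr1; ring.
Qed.

Lemma bounded_second_moment_ge0 : 0 <= s2.
Proof. by rewrite -lee_fin -(meanV2 0%N) mean_ge0. Qed.

Let mean_ge0_real : 0 <= m.
Proof. by rewrite -lee_fin -(meanV 0%N) mean_ge0. Qed.

Lemma bounded_variance n :
  (\int[P]_w (((partial_sum V n w)%:R - n%:R * m) ^+ 2)%:E = (n%:R * (s2 - m * m))%:E)%E.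
Proof.
set I := (\int[_]_w _)%E.
have nm0 : 0 <= n%:R * m by rewrite mulr_ge0.
have : (I + (2 * (n%:R * m))%:E * mean P (partial_sum V n) =
    mean P (fun w => partial_sum V n w ^ 2)%N + ((n%:R * m) ^+ 2)%:E)%E.
  rewrite /mean -ge0_integralZl_EFin//; last 2 first.
  - exact: (measurable_fun_nat (fun k => k%:R%:E)).
  - by rewrite mulr_ge0.
  rewrite -ge0_integralD//; last 4 first.
  - by move=> w _; rewrite lee_fin sqr_ge0.
  - exact: (measurable_fun_nat (fun k => ((k%:R - n%:R * m) ^+ 2)%:E)).
  - by move=> w _; rewrite mule_ge0// lee_fin mulr_ge0.
  - exact: (measurable_fun_nat (fun k => ((2 * (n%:R * m))%:E * k%:R%:E)%E)).
  have -> : ((n%:R * m) ^+ 2)%:E = (\int[P]_w ((n%:R * m) ^+ 2)%:E)%E.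
    by rewrite integral_cst// [X in (_ * X)%E]probability_setT mule1.
  rewrite -ge0_integralD//; last 2 first.
  - exact: (measurable_fun_nat (fun k => (k ^ 2)%:R%:E)).
  - by move=> w _; rewrite lee_fin sqr_ge0.
  apply: eq_integral => w _ /=; rewrite -EFinM -!EFinD natrX; congr EFin; ring.
rewrite meanS2 meanS -EFinM -EFinD => H.
have -> : I = (I + (2 * (n%:R * m) * (n%:R * m))%:E -
               (2 * (n%:R * m) * (n%:R * m))%:E)%E by rewrite addeK.
by rewrite H -EFinB; congr EFin; ring.
Qed.

Lemma bounded_chebyshev n (t : R) : 0 < t ->
  (P [set w | (t <= `|(partial_sum V n w)%:R - n%:R * m|)%R] <=
     (n%:R * s2 / t ^+ 2)%:E)%E.
Proof.
move=> t0; set E := [set w | _].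
have mE : measurable E.
  exact: (mS n [set k | t <= `|k%:R - n%:R * m|]).
have t2 : 0 < t ^+ 2 by rewrite exprn_gt0.
rewrite EFinM lee_pdivlMr//.
have : (\int[P]_w ((t ^+ 2)%:E * (\1_E w)%:E) <=
        \int[P]_w (((partial_sum V n w)%:R - n%:R * m) ^+ 2)%:E)%E.
  apply: ge0_le_integral => //.
  - by move=> w _; rewrite mule_ge0// lee_fin// ltW.
  - by apply/measurable_EFinP; apply: measurable_funM.
  - exact: (measurable_fun_nat (fun k => ((k%:R - n%:R * m) ^+ 2)%:E)).
  - move=> w _; rewrite -EFinM lee_fin indicE.
    have [/set_mem wE|_] := boolP (w \in E); last by rewrite mulr0 sqr_ge0.
    rewrite mulr1 -[leRHS]real_normK ?num_real// ler_sqr ?nnegrE// ltW//.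
rewrite ge0_integralZl_EFin//; last 2 first.
  - by apply/measurable_EFinP.
  - exact: ltW.
rewrite integral_indic// setIT bounded_variance muleC => /le_trans; apply.
by rewrite lee_fin ler_wpM2l// lerBlDr lerDl mulr_ge0.
Qed.

End bounded.
End law_of_large_numbers.

Section interpolation.
Context {R : realType}.
Implicit Types (s : nat -> nat) (m e c : R).

Lemma square_bracket n : exists j, (j ^ 2 <= n < j.+1 ^ 2)%N.
Proof.
elim: n => [|n [j /andP[jn nj]]]; first by exists 0%N.
have [nj1|nj1] := ltnP n.+1 (j.+1 ^ 2).
  by exists j; rewrite nj1 andbT (leq_trans jn).
exists j.+1; rewrite nj1 /=; nia.
Qed.

Lemma square_interpolation s m e k0 :
  {homo s : a b / (a <= b)%N} -> 0 <= m -> 0 < e ->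
  (forall j, (k0 <= j)%N -> `|(s (j ^ 2)%N)%:R - (j ^ 2)%N%:R * m| <= e * (j ^ 2)%N%:R) ->
  \forall n \near \oo, `|(s n)%:R - n%:R * m| <= 2 * e * n%:R.
Proof.
move=> ss m0 e0 H.
have [k1 hk1] : exists k1 : nat, 3 * (m + e) <= e * k1%:R.
  exists (Num.bound (3 * (m + e) / e)); rewrite [leRHS]mulrC -ler_pdivrMr//.
  by apply/ltW/archi_boundP; rewrite divr_ge0 ?mulr_ge0 ?addr_ge0// ltW.
exists ((maxn k0 k1).+2 ^ 2)%N => // n /= hn.
have [j /andP[jn nj]] := square_bracket n.
have jk : (maxn k0 k1 < j)%N.
  rewrite -ltnS -(@ltn_sqr _ j.+1) (leq_ltn_trans _ nj)//.
  by apply: leq_trans hn; rewrite leq_sqr.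
have := H j; have := H j.+1.
have -> : (k0 <= j.+1)%N by lia.
have -> : (k0 <= j)%N by lia.
have k1j : k1%:R <= j%:R :> R by rewrite ler_nat; lia.
have j1 : 1 <= j%:R :> R by rewrite (ler_nat _ 1); lia.
move=> /(_ isT); rewrite ler_norml => /andP[_ h1].
move=> /(_ isT); rewrite ler_norml => /andP[h2 _].
have sj : (s (j ^ 2)%N)%:R <= (s n)%:R :> R by rewrite ler_nat ss.
have sj1 : (s n)%:R <= (s (j.+1 ^ 2)%N)%:R :> R by rewrite ler_nat ss// ltnW.
have jnR : j%:R ^+ 2 <= n%:R :> R by rewrite -natrX ler_nat.
have njR : n%:R <= (j%:R + 1) ^+ 2 :> R by rewrite natr1 -natrX ler_nat ltnW.
move: h1 h2; rewrite !natrX -natr1 => h1 h2.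
have key : (2 * j%:R + 1) * (m + e) <= e * j%:R ^+ 2.
  apply: (@le_trans _ _ (3 * (m + e) * j%:R)).
    rewrite [leRHS]mulrAC; apply: ler_wpM2r; first by lra.
    by lra.
  rewrite expr2 mulrA; apply: ler_wpM2r; first lra.
  by apply: (le_trans hk1); rewrite ler_wpM2l// ltW.
have ejn : e * j%:R ^+ 2 <= e * n%:R by rewrite ler_wpM2l// ltW.
have mjn : m * j%:R ^+ 2 <= m * n%:R by rewrite ler_wpM2l.
have mnj : m * n%:R <= m * (j%:R + 1) ^+ 2 by rewrite ler_wpM2l.
rewrite ler_norml; apply/andP; split; nra.
Qed.

Lemma dyadic_interpolation s c k0 :
  {homo s : a b / (a <= b)%N} -> 0 <= c ->
  (forall k, (k0 <= k)%N -> (s (2 ^ k)%N)%:R <= c * (2 ^ k)%N%:R) ->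
  \forall n \near \oo, (s n)%:R <= 2 * c * n%:R.
Proof.
move=> ss c0 H; exists (2 ^ k0)%N => // n /= hn.
have n0 : (0 < n)%N by apply: leq_trans hn; rewrite expn_gt0.
have /andP[kn nk] := trunc_log_bounds (isT : 1 < 2)%N n0.
set k := trunc_log 2 n in kn nk *.
have k0k : (k0 <= k)%N by apply: trunc_log_max.
apply: (@le_trans _ _ (s (2 ^ k.+1)%N)%:R); first by rewrite ler_nat ss// ltnW.
apply: (le_trans (H k.+1 _)); first by rewrite leqW.
rewrite expnS natrM mulrA [c * _]mulrC ler_wpM2l ?ler_nat// mulr_ge0//.
Qed.

End interpolation.

Lemma truncated_square_sum x N :
  (\sum_(k < N) 2 ^ (N - k) * minn x (2 ^ k) ^ 2 <= 2 ^ N * (4 * x))%N.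
Proof.
pose G N := (\sum_(k < N) 2 ^ (N - k) * minn x (2 ^ k) ^ 2)%N.
have GS M : G M.+1 = (2 * (G M + minn x (2 ^ M) ^ 2))%N.
  rewrite /G big_ord_recr /= subSnn expn1 mulnDr big_distrr /=; congr addn.
  by apply: eq_bigr => k _; rewrite subSn ?expnS ?mulnA// ltnW.
rewrite -/(G N).
suff : if (2 ^ N <= x)%N then (G N <= (2 ^ N) ^ 2)%N
       else (G N + 2 * x ^ 2 <= 4 * x * 2 ^ N)%N.
  by case: ifPn; nia.
elim: N => [|N].
  by rewrite /G big_ord0 expn0; case: ifPn => //; rewrite -ltnNge ltnS leqn0 => /eqP ->.
rewrite GS (expnS 2 N); set t := (2 ^ N)%N; set g := G N.
have t0 : (0 < t)%N by rewrite expn_gt0.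
case: leqP => [tx|xt] IH.
  by case: leqP => t2x; nia.
by case: leqP => t2x; nia.
Qed.

Section strong_law.
Context {R : realType} {d : measure_display} {T : measurableType d}.
Variable P : probability T R.
Implicit Types (V : nat -> T -> nat) (S : set nat).

Lemma partial_sum_homo V w : {homo partial_sum V ^~ w : a b / (a <= b)%N}.
Proof.
apply: homo_leq => [n|b a c|n]; [exact: leqnn|exact: leq_trans|].
by rewrite /partial_sum big_ord_recr leq_addr.
Qed.

Lemma nat_measurable_partial_sum V n :
  (forall i, nat_measurable (V i)) -> nat_measurable (partial_sum V n).
Proof. exact: nat_measurable_sum. Qed.

Lemma inverse_square_sum N : \sum_(k < N) (k.+1%:R ^- 2 : R) <= 2.
Proof.
suff : \sum_(k < N.+1) (k.+1%:R ^- 2 : R) <= 2 - N.+1%:R^-1.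
  rewrite big_ord_recr /= => H; apply: le_trans (le_trans H _).
    by rewrite lerDl.
  by rewrite gerBl.
elim: N => [|N IHN]; first by rewrite big_ord1 /=; lra.
rewrite big_ord_recr /=; apply: le_trans (lerD IHN (lexx _)) _.
have N0 : (0 : R) < N.+1%:R by [].
rewrite -(natr1 N.+1).
set x := N.+1%:R : R in N0 *.
have x1 : 0 < x + 1 by rewrite addr_gt0.
rewrite -subr_ge0 (_ : _ - _ = (x * (x + 1) ^+ 2)^-1); last first.
  by field; rewrite !gt_eqF.
by rewrite invr_ge0 mulr_ge0 ?exprn_ge0// ltW.
Qed.

Lemma bounded_lln V K (e : R) : pairwise_iid P V -> (forall i w, V i w <= K)%N ->
  0 < e ->
  {ae P, forall w, \forall n \near \oo,
    `|(partial_sum V n w)%:R - n%:R * fine (mean P (V 0%N))| <= e * n%:R}.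
Proof.
move=> iidV VK e0; set m := fine _.
have m0 : 0 <= m by rewrite fine_ge0// mean_ge0.
have e20 : 0 < e / 2 by rewrite divr_gt0.
pose s2 := fine (mean P (fun w => V 0%N w ^ 2)%N).
pose E k := [set w | e / 2 * (k.+1 ^ 2)%N%:R <=
  `|(partial_sum V (k.+1 ^ 2)%N w)%:R - (k.+1 ^ 2)%N%:R * m|].
have mS n : nat_measurable (partial_sum V n).
  by apply: nat_measurable_partial_sum; case: iidV.
have : {ae P, forall w, \forall k \near \oo, ~ E k w}.
  apply: (@borel_cantelli_ae _ _ _ P E
    (fun k => s2 / (e / 2) ^+ 2 * k.+1%:R ^- 2) (s2 / (e / 2) ^+ 2 * 2)).
  - move=> k; exact: (mS (k.+1 ^ 2)%N
      [set a | e / 2 * (k.+1 ^ 2)%N%:R <= `|a%:R - (k.+1 ^ 2)%N%:R * m|]).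
  - move=> k; apply: le_trans (bounded_chebyshev iidV VK _ _) _.
      by rewrite mulr_gt0// ltr0n expn_gt0.
    rewrite lee_fin -/s2 natrX le_eqVlt; apply/orP; left; apply/eqP.
    by field; rewrite nat1r pnatr_eq0 /= gt_eqF.
  - move=> N; rewrite -mulr_sumr ler_wpM2l ?inverse_square_sum// divr_ge0 ?sqr_ge0//.
    exact: (bounded_second_moment_ge0 iidV VK).
apply: filterS => w [k0 _ H].
have := @square_interpolation R (partial_sum V ^~ w) m (e / 2) k0.+1
  (partial_sum_homo V w) m0 e20.
rewrite [2 * (e / 2)]mulrC divfK//; apply => -[//|j]; rewrite ltnS => k0j.
by have /= /negP := H j k0j; rewrite -ltNge => /ltW.
Qed.

Lemma markov_nat (W : T -> nat) c : nat_measurable W ->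
  (c%:R%:E * P (W @^-1` [set k | (c <= k)%N]) <= mean P W)%E.
Proof.
move=> mW; apply: (@le_trans _ _ (mean P (fun w => minn (W w) c))); last first.
  apply: mean_le => //; last by move=> w; exact: geq_minl.
  exact: (nat_measurable_comp (fun k => minn k c)).
rewrite mean_minn// (probE P (mW _)) -EFinM.
rewrite (_ : _%:E = \sum_(k < c) P (W @^-1` [set k | (c <= k)%N]))%E.
  apply: lee_sum => k _; apply: le_measure; rewrite ?inE//.
  by move=> w /= cW; rewrite (leq_trans _ cW).
by rewrite (probE P (mW _)) sumEFin sumr_const card_ord mulr_natl.
Qed.

Lemma meanZ c (W : T -> nat) : nat_measurable W ->
  mean P (fun w => c * W w)%N = (c%:R%:E * mean P W)%E.
Proof.
move=> mW; rewrite /mean -ge0_integralZl_EFin//.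
  by apply: eq_integral => w _; rewrite natrM.
exact: (measurable_fun_nat (fun k => k%:R%:E)).
Qed.

(* A weak bound with a lossy constant suffices, as it is only applied to tails of small mean. *)
Lemma iid_sum_bound V (e : R) : pairwise_iid P V -> (mean P (V 0%N) < e%:E)%E ->
  {ae P, forall w, \forall n \near \oo, (partial_sum V n w)%:R <= 4 * e * n%:R}.
Proof.
move=> iidV me.
have [mV indV eqV] := iidV.
have e0 : 0 < e by rewrite -lte_fin (le_lt_trans _ me)// mean_ge0.
pose mu := fine (mean P (V 0%N)).
have muE : mean P (V 0%N) = mu%:E.
  by rewrite fineK// ge0_fin_numE ?mean_ge0// (lt_trans me)// ltry.
have mue : mu < e by rewrite -lte_fin -muE.
pose W k i w := minn (V i w) (2 ^ k)%N.
have iidW k : pairwise_iid P (W k) by exact: (pairwise_iid_comp (fun a => minn a (2 ^ k)%N)).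
have Wk k i w : (W k i w <= 2 ^ k)%N by exact: geq_minr.
pose m k := fine (mean P (W k 0%N)).
pose s2 k := fine (mean P (fun w => W k 0%N w ^ 2)%N).
have mW k : nat_measurable (W k 0%N) by have [] := iidW k.
have mW2 k : nat_measurable (fun w => W k 0%N w ^ 2)%N.
  exact: (nat_measurable_comp (fun a => a ^ 2)%N).
have mle k : m k <= e.
  rewrite -lee_fin (le_trans _ (ltW me))// /m fineK.
    by apply: mean_le => // w; exact: geq_minl.
  rewrite ge0_fin_numE ?mean_ge0// (@le_lt_trans _ _ mu%:E) ?ltry//.
  by rewrite -muE; apply: mean_le => // w; exact: geq_minl.
have s2E k : mean P (fun w => W k 0%N w ^ 2)%N = (s2 k)%:E.
  rewrite fineK// ge0_fin_numE ?mean_ge0//.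
  apply: (@le_lt_trans _ _ (mean P (fun=> (2 ^ k) ^ 2)%N)).
    by apply: mean_le => // [|w]; [exact: nat_measurable_cst|rewrite leq_sqr].
  by rewrite mean_cst ltry.
have s20 k : 0 <= s2 k by exact: (bounded_second_moment_ge0 (iidW k) (Wk k)).
have s2sum N : \sum_(k < N) s2 k / 2 ^+ k <= 4 * mu.
  have mZ k : nat_measurable (fun w => 2 ^ (N - k) * W k 0%N w ^ 2)%N.
    exact: (nat_measurable_comp (fun a => 2 ^ (N - k) * a)%N).
  have : (mean P (fun w => \sum_(k < N) 2 ^ (N - k) * W k 0%N w ^ 2)%N <=
          mean P (fun w => 2 ^ N * (4 * V 0%N w))%N)%E.
    apply: mean_le; last by move=> w; exact: truncated_square_sum.
      exact: (@nat_measurable_sum _ _ (fun k w => 2 ^ (N - k) * W k 0%N w ^ 2)%N).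
    exact: (nat_measurable_comp (fun a => 2 ^ N * (4 * a))%N).
  rewrite (mean_sum P (W := fun k w => 2 ^ (N - k) * W k 0%N w ^ 2)%N)//.
  under eq_bigr do rewrite meanZ// s2E -EFinM.
  rewrite sumEFin meanZ; last exact: (nat_measurable_comp (fun a => 4 * a)%N).
  rewrite meanZ// muE -!EFinM lee_fin => H.
  rewrite -(@ler_pM2l _ (2 ^ N)%N%:R) ?ltr0n ?expn_gt0//.
  apply: le_trans H; rewrite mulr_sumr; apply: ler_sum => k _.
  have -> : (2 ^ N)%N%:R = (2 ^ (N - k))%N%:R * 2 ^+ k :> R.
    by rewrite -natrX -natrM -expnD subnK// ltnW.
  rewrite le_eqVlt; apply/orP; left; apply/eqP; field.
  by rewrite expf_neq0// pnatr_eq0.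
pose E k := [set w | 2 * e * (2 ^ k)%N%:R < (partial_sum V (2 ^ k)%N w)%:R].
have mS n : nat_measurable (partial_sum V n) by exact: nat_measurable_partial_sum.
have mE k : measurable (E k).
  exact: (mS (2 ^ k)%N [set a | 2 * e * (2 ^ k)%N%:R < a%:R]).
have p2 k : 0 < (2 ^ k)%N%:R :> R by rewrite ltr0n expn_gt0.
have PE k : (P (E k) <= ((e ^- 2 + 1) * (s2 k / 2 ^+ k))%:E)%E.
  pose E1 := [set w | e * (2 ^ k)%N%:R <=
    `|(partial_sum (W k) (2 ^ k)%N w)%:R - (2 ^ k)%N%:R * m k|].
  pose F i := V i @^-1` [set a | (2 ^ k < a)%N].
  pose E2 := \big[setU/set0]_(i < 2 ^ k) F i.
  have mE1 : measurable E1.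
    have mSW : nat_measurable (partial_sum (W k) (2 ^ k)%N).
      by apply: nat_measurable_partial_sum; have [] := iidW k.
    exact: (mSW [set a | e * (2 ^ k)%N%:R <= `|a%:R - (2 ^ k)%N%:R * m k|]).
  have mE2 : measurable E2 by apply: bigsetU_measurable => i _; exact: mV.
  have EE : E k `<=` E1 `|` E2.
    move=> w Ekw; have [?|nE2] := pselect (E2 w); [by right|left].
    have WV : partial_sum V (2 ^ k)%N w = partial_sum (W k) (2 ^ k)%N w.
      apply: eq_bigr => i _; apply/esym/minn_idPl; rewrite leqNgt.
      apply/negP => Vi; apply: nE2; rewrite /E2 -bigcup_mkord.
      by exists i => //=.
    rewrite /E1 /=; move: Ekw; rewrite /E /= WV => H.
    rewrite (le_trans _ (ler_norm _))// lerBrDr.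
    have : (2 ^ k)%N%:R * m k <= (2 ^ k)%N%:R * e by rewrite ler_wpM2l.
    by move: H; set x := (2 ^ k)%N%:R; lra.
  apply: (@le_trans _ _ (P E1 + P E2)%E).
    apply: (@le_trans _ _ (P (E1 `|` E2))); last exact: measureU2.
    by apply: le_measure => //; rewrite inE//; exact: measurableU.
  rewrite mulrDl EFinD; apply: leeD.
    apply: le_trans (bounded_chebyshev (iidW k) (Wk k) _ _) _.
      by rewrite mulr_gt0.
    rewrite lee_fin -/(s2 k) natrX le_eqVlt; apply/orP; left; apply/eqP.
    by field; rewrite expf_neq0// gt_eqF.
  have Q : (P E2 <= (2 ^ k)%N%:R%:E * P (V 0%N @^-1` [set a | (2 ^ k < a)%N]))%E.
    apply: (@le_trans _ _ (\sum_(i < 2 ^ k) P (F i))%E).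
      by apply: Boole_inequality => i _; exact: mV.
    under eq_bigr do rewrite /F eqV.
    by rewrite (probE P (mV _ _)) sumEFin sumr_const card_ord -EFinM mulr_natl.
  apply: (le_trans Q).
  have := markov_nat (2 ^ k * 2 ^ k)%N (mW2 k); rewrite s2E.
  have QQ : (P (V 0%N @^-1` [set a | (2 ^ k < a)%N]) <=
    P ((fun w => W k 0%N w ^ 2)%N @^-1` [set a | (2 ^ k * 2 ^ k <= a)%N]))%E.
    apply: le_measure; rewrite ?inE//; [exact: mV|exact: (mW2 k)|].
    by move=> w /= kV; rewrite /W (minn_idPr (ltnW kV)).
  rewrite (probE P (mW2 _ _)) in QQ *; rewrite (probE P (mV _ _)) in QQ *.
  rewrite -!EFinM !lee_fin in QQ *.
  set q := fine _ in QQ *; set q' := fine _ in QQ *.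
  rewrite mul1r ler_pdivlMr ?exprn_gt0// natrM -natrX => H.
  apply: le_trans H; rewrite [leLHS]mulrC mulrA ler_wpM2l// mulr_ge0//.
have : {ae P, forall w, \forall k \near \oo, ~ E k w}.
  apply: (borel_cantelli_ae (C := (e ^- 2 + 1) * (4 * mu)) mE PE) => N.
  by rewrite -mulr_sumr ler_wpM2l// addr_ge0// invr_ge0 sqr_ge0.
apply: filterS => w [k0 _ H].
have := @dyadic_interpolation R (partial_sum V ^~ w) (2 * e) k0 (partial_sum_homo V w).
rewrite [2 * (2 * e)]mulrA -natrM; apply; first by rewrite mulr_ge0// ltW.
by move=> k kk0; have /negP := H k kk0; rewrite -leNgt.
Qed.

Lemma mean_minn_gt (W : T -> nat) (K : R) : nat_measurable W ->
  (K%:E < mean P W)%E -> exists M, (K%:E < mean P (fun w => minn (W w) M))%E.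
Proof.
move=> mW; have cvgW := @mean_minn_cvg _ _ _ P _ mW.
apply: contraPP => /forallNP H; apply/negP; rewrite -leNgt.
rewrite -(cvg_lim _ cvgW)//; apply: lime_le; first by apply/cvg_ex; exists (mean P W).
by apply: nearW => M; rewrite leNgt; apply/negP/H.
Qed.

Lemma mean_minnE (W : T -> nat) M : nat_measurable W ->
  mean P (fun w => minn (W w) M) = (fine (mean P (fun w => minn (W w) M)))%:E.
Proof.
move=> mW; rewrite fineK// ge0_fin_numE ?mean_ge0//.
apply: (@le_lt_trans _ _ (mean P (fun=> M))); last by rewrite mean_cst ltry.
apply: mean_le => [||w]; [|exact: nat_measurable_cst|exact: geq_minr].
exact: (nat_measurable_comp (fun k => minn k M)).
Qed.

Lemma lln_ge V (K : R) : pairwise_iid P V -> (K%:E < mean P (V 0%N))%E ->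
  {ae P, forall w, \forall n \near \oo, K * n%:R <= (partial_sum V n w)%:R}.
Proof.
move=> iidV KV; have [mV _ _] := iidV.
have [M KM] := mean_minn_gt (mV 0%N) KV.
have iidW := pairwise_iid_comp (fun k => minn k M) iidV.
pose m := fine (mean P (fun w => minn (V 0%N w) M)).
have Km : K < m by rewrite -lte_fin /m -mean_minnE.
have : 0 < m - K by rewrite subr_gt0.
move=> /(bounded_lln iidW (fun _ _ => geq_minr _ _)).
apply: filterS => w; apply: filterS => n; rewrite -/m ler_norml => /andP[+ _].
have : (partial_sum (fun i w => minn (V i w) M) n w)%:R <= (partial_sum V n w)%:R :> R.
  by rewrite ler_nat; apply: leq_sum => i _; exact: geq_minl.
by rewrite mulrBl [n%:R * m]mulrC; lra.
Qed.

Lemma lln_le V (K : R) : pairwise_iid P V -> (mean P (V 0%N) < K%:E)%E ->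
  {ae P, forall w, \forall n \near \oo, (partial_sum V n w)%:R <= K * n%:R}.
Proof.
move=> iidV VK; have [mV _ _] := iidV.
pose mu := fine (mean P (V 0%N)).
have muE : mean P (V 0%N) = mu%:E.
  by rewrite fineK// ge0_fin_numE ?mean_ge0// (lt_trans VK)// ltry.
have muK : mu < K by rewrite -lte_fin -muE.
pose e := (K - mu) / 5.
have e0 : 0 < e by rewrite divr_gt0// subr_gt0.
have [M KM] : exists M, ((mu - e)%:E < mean P (fun w => minn (V 0%N w) M))%E.
  by apply: mean_minn_gt => //; rewrite muE lte_fin gtrBl.
pose m := fine (mean P (fun w => minn (V 0%N w) M)).
have mE : mean P (fun w => minn (V 0%N w) M) = m%:E by exact: mean_minnE.
have Km : mu - e < m by rewrite -lte_fin -mE.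
have iidW := pairwise_iid_comp (fun k => minn k M) iidV.
have iidU := pairwise_iid_comp (fun k => k - M)%N iidV.
have split_mean : (m%:E + mean P (fun w => V 0%N w - M)%N)%E = mu%:E.
  rewrite -mE -meanD.
  - by rewrite -muE; congr mean; apply/funext => w; lia.
  - exact: (nat_measurable_comp (fun k => minn k M)).
  - exact: (nat_measurable_comp (fun k => k - M)%N).
have Ue : (mean P (fun w => V 0%N w - M)%N < e%:E)%E.
  rewrite -(@lteD2lE _ m%:E)// split_mean -EFinD lte_fin; lra.
have mmu : m <= mu.
  by rewrite -lee_fin -split_mean leeDl// mean_ge0.
near=> w => /=.
have : \forall n \near \oo, (partial_sum (fun i w => V i w - M)%N n w)%:R <= 4 * e * n%:R :> R.
  by near: w; exact: (iid_sum_bound iidU Ue).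
have : \forall n \near \oo,
    `|(partial_sum (fun i w => minn (V i w) M) n w)%:R - n%:R * m| <= e * n%:R.
  by near: w; exact: (bounded_lln iidW (fun _ _ => geq_minr _ _) e0).
apply: filterS2 => n; rewrite ler_norml => /andP[_ h1] h2.
have -> : partial_sum V n w = (partial_sum (fun i w => minn (V i w) M) n w +
    partial_sum (fun i w => V i w - M) n w)%N.
  by rewrite /partial_sum -big_split; apply: eq_bigr => i _ /=; lia.
rewrite natrD.
have h3 : n%:R * m <= n%:R * mu by rewrite ler_wpM2l.
have h4 : 5 * e = K - mu by rewrite /e mulrC divfK.
have -> : K = 5 * e + mu by rewrite h4 subrK.
nra.
Unshelve. all: by end_near. Qed.

End strong_law.

(** * Independence of generated sigma-algebras *)

Section sigma_algebra_independence.
Context {R : realType} {d : measure_display} {T : measurableType d}.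
Variable P : probability T R.

Lemma indep_sigma_ext (C : set (set T)) (E : set T) :
  setI_closed C -> C `<=` measurable -> measurable E ->
  (forall G, C G -> P (G `&` E) = (P G * P E)%E) ->
  forall G, <<s C >> G -> P (G `&` E) = (P G * P E)%E.
Proof.
move=> CI Cm mE CE.
pose D := [set G | measurable G /\ P (G `&` E) = (P G * P E)%E].
suff : <<d C >> `<=` D by rewrite setI_closed_g_dynkin_g_sigma_algebra// => H G /H[].
apply: smallest_sub; last by move=> G CG; split; [exact: Cm|exact: CE].
split.
- by split=> //; rewrite setTI probability_setT mul1e.
- move=> G [mG GE]; split; first exact: measurableC.
  have PE : (P E = P (G `&` E) + P (~` G `&` E))%E.
    rewrite -measureU//; [|exact: measurableI| |].
    + by rewrite -setIUl setUv setTI.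
    + by apply: measurableI => //; exact: measurableC.
    + by rewrite setIACA setICr set0I.
  move: PE; rewrite GE probability_setC//.
  have mCGE : measurable (~` G `&` E) by apply: measurableI => //; exact: measurableC.
  rewrite (probE P mE) (probE P mG) (probE P mCGE) -EFinB -!EFinM -EFinD.
  by move=> H; have := EFin_inj H => H1; congr EFin; lra.
- move=> F tF DF.
  have mF i : measurable (F i) by have [] := DF i.
  split; first exact: bigcup_measurable.
  rewrite setI_bigcupl (prob_bigcup P (F := fun i => F i `&` E)); last 2 first.
  + by move=> i; exact: measurableI.
  + exact: trivIset_setIr.
  under eq_eseriesr => i _ do rewrite (DF i).2 (probE P mE) muleC.
  by rewrite nneseriesZl// -prob_bigcup// muleC -probE.
Qed.

Context {I : eqType}.
Variable V : I -> T -> R.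
Hypothesis indV : mutually_independent P V.
Implicit Types (A : I -> set R) (F : set I) (J : seq I).

Let mV i : measurable_fun setT (V i). Proof. by case: indV. Qed.

Definition rect A : set T := [set w | forall i, A i (V i w)].

Definition rect_on F : set (set T) :=
  [set G | exists J A, [/\ forall i, measurable (A i),
    forall i, i \notin J -> A i = setT, forall i, ~ F i -> A i = setT & G = rect A]].

Definition sigma_of F : set (set T) := <<s rect_on F >>.

Lemma measurable_preimage i (B : set R) : measurable B -> measurable (V i @^-1` B).
Proof. by move=> mB; rewrite -[X in measurable X]setTI; exact: mV. Qed.

Lemma rectE J A : (forall i, i \notin J -> A i = setT) ->
  rect A = \bigcap_(i in [set` J]) (V i @^-1` A i).
Proof.
move=> AJ; apply/seteqP; split=> w /= Aw i; first by move=> _; exact: Aw.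
have [iJ|/AJ ->//] := boolP (i \in J); exact: Aw.
Qed.

Lemma measurable_rect J A : (forall i, measurable (A i)) ->
  (forall i, i \notin J -> A i = setT) -> measurable (rect A).
Proof.
move=> mA /rectE ->; elim: J => [|j J IHJ].
  rewrite (_ : [set` _] = set0) ?bigcap_set0//.
  by apply/seteqP; split.
rewrite (_ : \bigcap_(i in _) _ = V j @^-1` A j `&` \bigcap_(i in [set` J]) (V i @^-1` A i)).
  by apply: measurableI => //; exact: measurable_preimage.
apply/seteqP; split=> w /=.
  move=> H; split; first by apply: (H j) => /=; rewrite mem_head.
  by move=> i /= iJ; apply: (H i) => /=; rewrite in_cons iJ orbT.
by move=> [Hj HJ] i /=; rewrite in_cons => /predU1P[->//|iJ]; exact: HJ.
Qed.

Lemma prob_rect J A : (forall i, measurable (A i)) ->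
  (forall i, i \notin J -> A i = setT) ->
  P (rect A) = (\prod_(i <- undup J) fine (P (V i @^-1` A i)))%:E.
Proof.
move=> mA AJ; rewrite (probE P (measurable_rect mA AJ)); congr EFin.
have AuJ i : i \notin undup J -> A i = setT by rewrite mem_undup => /AJ.
by rewrite (rectE AuJ); case: indV => _ ->//; exact: undup_uniq.
Qed.

Lemma prob_rectI F F' G G' : (forall i, F i -> ~ F' i) ->
  rect_on F G -> rect_on F' G' -> P (G `&` G') = (P G * P G')%E.
Proof.
move=> FF' [J [A [mA AJ AF ->]]] [J' [A' [mA' AJ' AF' ->]]].
have -> : rect A `&` rect A' = rect (fun i => A i `&` A' i).
  apply/seteqP; split=> w /=; first by move=> [H H'] i; split; [exact: H|exact: H'].
  by move=> H; split=> i; have [] := H i.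
pose K := J ++ J'.
have KJ i : i \notin K -> A i = setT /\ A' i = setT.
  by rewrite mem_cat negb_or => /andP[/AJ ? /AJ' ?].
rewrite !(@prob_rect K)//.
- rewrite -EFinM -big_split; congr EFin; apply: eq_bigr => i _ /=.
  have [Fi|nFi] := pselect (F i).
    rewrite (AF' i (FF' i Fi)) setIT (_ : V i @^-1` setT = setT)//.
    by rewrite probability_setT mulr1.
  rewrite (AF i nFi) setTI (_ : V i @^-1` setT = setT)//.
  by rewrite probability_setT mul1r.
- by move=> i /KJ[].
- by move=> i /KJ[].
- by move=> i; exact: measurableI.
- by move=> i /KJ[-> ->]; rewrite setIT.
Qed.

Lemma setI_closed_rect_on F : setI_closed (rect_on F).
Proof.
move=> G G' [J [A [mA AJ AF ->]]] [J' [A' [mA' AJ' AF' ->]]].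
exists (J ++ J'), (fun i => A i `&` A' i); split.
- by move=> i; exact: measurableI.
- by move=> i; rewrite mem_cat negb_or => /andP[/AJ -> /AJ' ->]; rewrite setIT.
- by move=> i nF; rewrite AF// AF'// setIT.
apply/seteqP; split=> w /=; first by move=> [H H'] i; split; [exact: H|exact: H'].
by move=> H; split=> i; have [] := H i.
Qed.

Lemma rect_on_measurable F : rect_on F `<=` measurable.
Proof. by move=> _ [J [A [mA AJ _ ->]]]; exact: (measurable_rect mA AJ). Qed.

Lemma sigma_of_measurable F : sigma_of F `<=` measurable.
Proof. apply: smallest_sub; [exact: sigma_algebra_measurable|exact: rect_on_measurable]. Qed.

Lemma sigma_of_indep F F' E E' : (forall i, F i -> ~ F' i) ->
  sigma_of F E -> sigma_of F' E' -> P (E `&` E') = (P E * P E')%E.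
Proof.
move=> FF' sE sE'.
apply: (@indep_sigma_ext (rect_on F)) sE.
- exact: setI_closed_rect_on.
- exact: rect_on_measurable.
- exact: sigma_of_measurable sE'.
move=> G rG; rewrite setIC muleC.
apply: (@indep_sigma_ext (rect_on F')) sE'.
- exact: setI_closed_rect_on.
- exact: rect_on_measurable.
- exact: rect_on_measurable rG.
by move=> G' rG'; rewrite setIC muleC; exact: (prob_rectI FF').
Qed.

Lemma sigma_of_sub F F' E : sigma_of F E -> F `<=` F' -> sigma_of F' E.
Proof.
move=> + FF'; apply: sub_smallest2r; first exact: smallest_sigma_algebra.
move=> G [J [A [mA AJ AF GE]]].
exists J, A; split => // i nF'; apply: AF; exact: contra_not (FF' i) nF'.
Qed.

Lemma sigma_ofT F : sigma_of F setT.
Proof. by case: (smallest_sigma_algebra setT (rect_on F)) => s0 sC _; rewrite -(setD0 setT); exact: sC. Qed.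

Lemma sigma_ofC F E : sigma_of F E -> sigma_of F (~` E).
Proof. by move=> sE; rewrite -setTD; case: (smallest_sigma_algebra setT (rect_on F)) => _ + _; apply. Qed.

Lemma sigma_of_bigcup F (E : nat -> set T) :
  (forall n, sigma_of F (E n)) -> sigma_of F (\bigcup_n E n).
Proof. by case: (smallest_sigma_algebra setT (rect_on F)) => _ _; apply. Qed.

Lemma sigma_of0 F : sigma_of F set0.
Proof. by rewrite -setCT; apply: sigma_ofC; exact: sigma_ofT. Qed.

Lemma sigma_ofU F E E' : sigma_of F E -> sigma_of F E' -> sigma_of F (E `|` E').
Proof.
move=> sE sE'; rewrite -bigcup2E; apply: sigma_of_bigcup => -[|[|n]] //=.
exact: sigma_of0.
Qed.

Lemma sigma_ofI F E E' : sigma_of F E -> sigma_of F E' -> sigma_of F (E `&` E').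
Proof.
move=> sE sE'; rewrite -[X in sigma_of _ X]setCK setCI.
by apply: sigma_ofC; apply: sigma_ofU; apply: sigma_ofC.
Qed.

Lemma sigma_of_preimage F i (B : set R) : F i -> measurable B ->
  sigma_of F (V i @^-1` B).
Proof.
move=> Fi mB; apply: sub_sigma_algebra.
exists [:: i], (fun j => if j == i then B else setT); split.
- by move=> j; case: ifP.
- by move=> j; rewrite inE => /negbTE ->.
- by move=> j nFj; case: eqP => // ji; case: nFj; rewrite ji.
apply/seteqP; split=> w /=; first by move=> Bw j; case: eqP => [->|].
by move=> /(_ i); rewrite eqxx.
Qed.

End sigma_algebra_independence.

(** * Births and removals of the model *)

Section mean_scaling.
Context {R : realType} {d : measure_display} {T : measurableType d}.
Variable P : probability T R.

Lemma mean_scaled (W Y : T -> nat) (E : nat -> T -> bool) (c : R) :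
  nat_measurable Y -> (forall k, measurable [set w | E k w]) ->
  (forall w, exists N, forall M, (N <= M)%N -> (\sum_(k < M) E k w)%N = W w) ->
  (forall k, P [set w | E k w] = (c%:E * P (Y @^-1` [set j | (k < j)%N]))%E) ->
  mean P W = (c%:E * mean P Y)%E.
Proof.
move=> mY mE EW EY.
have mEb k : nat_measurable (fun w => E k w : nat).
  by apply: (nat_measurable_bool (mE k)).
have : mean P (fun w => \sum_(k < M) E k w)%N @[M --> \oo] --> mean P W.
  apply: mean_cvg => // [M|M w].
    exact: (@nat_measurable_sum _ _ (fun k w => E k w : nat)).
  by rewrite big_ord_recr leq_addr.
have -> : (fun M => mean P (fun w => \sum_(k < M) E k w)%N) =
    (fun M => c%:E * \sum_(k < M) P (Y @^-1` [set j | (k < j)%N]))%E.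
  apply/funext => M; rewrite (mean_sum P (W := fun k w => E k w : nat))//.
  rewrite ge0_sume_distrr//; apply: eq_bigr => k _.
  by rewrite -EY; apply: mean_bool.
move=> /cvg_lim <- //; apply/cvg_lim => //.
by apply: cvgeZl => //; exact: mean_tail_cvg.
Qed.

End mean_scaling.

Section model.
Context {R : realType} {d : measure_display} {T : measurableType d}.
Variables (P : probability T R) (p : R) (B : nat -> T -> bool).
Variables (X Z : nat -> T -> nat) (U : nat -> nat -> T -> R).
Hypothesis ind : mutually_independent P (sources B X Z U).
Hypothesis PB : forall n, P [set w | B n w] = p%:E.
Hypothesis eqX : forall n k, P [set w | X n w = k] = P [set w | X 0%N w = k].
Hypothesis eqZ : forall n k, P [set w | Z n w = k] = P [set w | Z 0%N w = k].
Hypothesis lawU : forall n k, has_law P (U n k) (unif 0 1).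

Local Notation V := (sources B X Z U).

Definition src_time (s : src) : nat :=
  match s with SB n => n | SX n => n | SZ n => n | SU n _ => n end.

Let natset (S : set nat) : set R := \bigcup_(k in S) [set k%:R].

Let measurable_natset S : measurable (natset S).
Proof. by apply: bigcup_measurable => k _; exact: measurable_set1. Qed.

Let natsetP (S : set nat) k : natset S k%:R <-> S k.
Proof.
split=> [[j Sj /= /eqP]|Sk]; last by exists k.
by rewrite eqr_nat => /eqP ->.
Qed.

Lemma sigma_of_B F n b : F (SB n) -> sigma_of V F [set w | B n w = b].
Proof.
move=> Fn; rewrite (_ : [set w | _] = V (SB n) @^-1` natset [set (b : nat)]).
  exact: sigma_of_preimage.
apply/seteqP; split=> w /=.
  by move=> <-; apply/natsetP.
by move=> /natsetP /=; case: (B n w); case: (b).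
Qed.

Lemma sigma_of_Z F n S : F (SZ n) -> sigma_of V F (Z n @^-1` S).
Proof.
move=> Fn; rewrite (_ : _ @^-1` S = V (SZ n) @^-1` natset S).
  exact: sigma_of_preimage.
by apply/seteqP; split=> w /= /natsetP.
Qed.

Lemma sigma_of_X F n S : F (SX n) -> sigma_of V F (X n @^-1` S).
Proof.
move=> Fn; rewrite (_ : _ @^-1` S = V (SX n) @^-1` natset S).
  exact: sigma_of_preimage.
by apply/seteqP; split=> w /= /natsetP.
Qed.

Lemma sigma_of_U F n k D : F (SU n k) -> measurable D -> sigma_of V F (U n k @^-1` D).
Proof. by move=> Fn mD; exact: (sigma_of_preimage (V := V) (i := SU n k)). Qed.

Let sm F E : sigma_of V F E -> measurable E.
Proof. exact: (sigma_of_measurable ind). Qed.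

Lemma nat_measurable_X n : nat_measurable (X n).
Proof. by move=> S; apply: (@sm setT); exact: sigma_of_X. Qed.

Lemma nat_measurable_Z n : nat_measurable (Z n).
Proof. by move=> S; apply: (@sm setT); exact: sigma_of_Z. Qed.

Lemma prob_U n k D : measurable D -> P (U n k @^-1` D) = unif 0 1 D.
Proof. by case: (lawU n k) => _; apply. Qed.

Lemma prob_B n b : P [set w | B n w = b] = (if b then p else 1 - p)%:E.
Proof.
case: b; first by rewrite -(PB n).
rewrite (_ : [set w | _] = ~` [set w | B n w]).
  rewrite probability_setC ?PB//.
  exact: (sm (@sigma_of_B setT n true _)).
by apply/seteqP; split=> w /=; case: (B n w).
Qed.

Lemma pairwise_iid_blocks (W : nat -> T -> nat) :
  (forall n S, sigma_of V [set s | src_time s = n] (W n @^-1` S)) ->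
  (forall n S, P (W n @^-1` S) = P (W 0%N @^-1` S)) -> pairwise_iid P W.
Proof.
move=> sW eW; split=> // [n S|i j S S' ij]; first exact: sm (sW n S).
apply: (sigma_of_indep ind) (sW i S) (sW j S') => s /= -> /eqP.
by rewrite (negbTE ij).
Qed.

Section gate.
Variables (c : bool) (Y : nat -> T -> nat) (sY : nat -> src).
Hypothesis YF : forall F n S, F (sY n) -> sigma_of V F (Y n @^-1` S).
Hypothesis YB : forall n m, sY n <> SB m.
Hypothesis eqY : forall n S, P (Y n @^-1` S) = P (Y 0%N @^-1` S).

Definition gated n w := if B n w == c then Y n w else 0%N.

Let gatedE n S : gated n @^-1` S =
  ([set w | B n w = c] `&` Y n @^-1` S) `|`
  ([set w | B n w = ~~ c] `&` Y n @^-1` [set _ | S 0%N]).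
Proof.
apply/seteqP; split=> w; rewrite /gated /=.
  case: eqP => [Bc SY|Bc SY]; [by left|right; split=> //].
  by move: Bc; case: (B n w); case: (c).
move=> [[-> ?]|[-> ?]]; first by rewrite eqxx.
by case: (c).
Qed.

Lemma sigma_of_gated F n S : F (SB n) -> F (sY n) -> sigma_of V F (gated n @^-1` S).
Proof.
move=> FB FY; rewrite gatedE; apply: sigma_ofU; apply: sigma_ofI;
  by [exact: sigma_of_B|exact: YF].
Qed.

Let indBY n b S : P ([set w | B n w = b] `&` Y n @^-1` S) =
  (P [set w | B n w = b] * P (Y n @^-1` S))%E.
Proof.
apply: (@sigma_of_indep _ _ _ _ _ _ ind [set SB n] [set sY n]).
- by move=> s /= -> /esym; exact: YB.
- exact: sigma_of_B.
- exact: YF.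
Qed.

Lemma gated_law n S : P (gated n @^-1` S) = P (gated 0%N @^-1` S).
Proof.
have H m : P (gated m @^-1` S) = (P [set w | B m w = c] * P (Y m @^-1` S) +
    P [set w | B m w = ~~ c] * P (Y m @^-1` [set _ | S 0%N]))%E.
  rewrite gatedE -!indBY measureU//.
  - by apply: (@sm setT); apply: sigma_ofI; [exact: sigma_of_B|exact: YF].
  - by apply: (@sm setT); apply: sigma_ofI; [exact: sigma_of_B|exact: YF].
  - rewrite -subset0 => w [[/= -> _] [/= + _]]; by case: (c).
by rewrite !H !prob_B !(eqY n).
Qed.

Lemma gated_mean : mean P (gated 0%N) =
  ((if c then p else 1 - p)%:E * mean P (Y 0%N))%E.
Proof.
have mY : nat_measurable (Y 0%N) by move=> S; apply: (@sm setT); exact: YF.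
apply: (@mean_scaled _ _ _ _ _ _ (fun k w => (B 0%N w == c) && (k < Y 0%N w)%N)) => //.
- move=> k; rewrite (_ : [set w | _] = [set w | B 0%N w = c] `&` Y 0%N @^-1` [set j | (k < j)%N]).
    by apply: (@sm setT); apply: sigma_ofI; [exact: sigma_of_B|exact: YF].
  by apply/seteqP; split=> w /=; [move=> /andP[/eqP]|move=> [-> ->]; rewrite eqxx].
- move=> w; exists (Y 0%N w) => M YM; rewrite /gated; case: eqP => _ /=.
    by rewrite -minn_sum_ltn; apply/minn_idPl.
  by rewrite big1.
- move=> k; rewrite -(prob_B 0) -indBY; congr (P _).
  by apply/seteqP; split=> w /=; [move=> /andP[/eqP]|move=> [-> ->]; rewrite eqxx].
Qed.

End gate.

(* [removal_demand] counts the vertices whose removal is requested at a step, even when the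
   state holds fewer of them. *)
Definition removal_demand := gated false X.
Definition births := gated true Z.

Let lawX n S : P (X n @^-1` S) = P (X 0%N @^-1` S).
Proof. by apply: eq_law_singl => //; exact: nat_measurable_X. Qed.

Let lawZ n S : P (Z n @^-1` S) = P (Z 0%N @^-1` S).
Proof. by apply: eq_law_singl => //; exact: nat_measurable_Z. Qed.

Lemma removal_demand_iid : pairwise_iid P removal_demand.
Proof.
apply: pairwise_iid_blocks => n S.
  by apply: (@sigma_of_gated _ _ SX) => //; exact: sigma_of_X.
by apply: (@gated_law _ _ SX) => //; exact: sigma_of_X.
Qed.

Lemma removal_demand_mean :
  mean P (removal_demand 0%N) = ((1 - p)%:E * mean P (X 0%N))%E.
Proof. by apply: (@gated_mean _ _ SX) => //; exact: sigma_of_X. Qed.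

Lemma births_iid : pairwise_iid P births.
Proof.
apply: pairwise_iid_blocks => n S.
  by apply: (@sigma_of_gated _ _ SZ) => //; exact: sigma_of_Z.
by apply: (@gated_law _ _ SZ) => //; exact: sigma_of_Z.
Qed.

Lemma births_mean : mean P (births 0%N) = (p%:E * mean P (Z 0%N))%E.
Proof. by apply: (@gated_mean _ _ SZ) => //; exact: sigma_of_Z. Qed.

Section counting.
Variables (D : pred R) (delta : R).
Hypothesis mD : measurable [set x | D x].
Hypothesis PD : unif 0 1 [set x | D x] = delta%:E.

Definition count_births n w := (\sum_(k < births n w) D (U n k w))%N.

Let cnt n z w := (\sum_(k < z) D (U n k w))%N.
Let Us n z : set src := [set s | exists2 k, (k < z)%N & s = SU n k].

Let cntS n z S : cnt n z.+1 @^-1` S =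
  (cnt n z @^-1` S `&` U n z @^-1` (~` [set x | D x])) `|`
  (cnt n z @^-1` [set a | S a.+1] `&` U n z @^-1` [set x | D x]).
Proof.
apply/seteqP; split=> w; rewrite /cnt /= big_ord_recr /=.
  by case: (D _) => /=; rewrite ?addn1 ?addn0 => ?; [right|left].
by move=> [[+ /negP/negbTE ->]|[+ ->]]; rewrite ?addn1 ?addn0.
Qed.

Let sigma_cnt n z S : sigma_of V (Us n z) (cnt n z @^-1` S).
Proof.
elim: z S => [|z IHz] S.
  have [S0|S0] := pselect (S 0%N).
    rewrite (_ : _ @^-1` _ = setT); first exact: sigma_ofT.
    by apply/seteqP; split=> w //= _; rewrite /cnt big_ord0.
  rewrite (_ : _ @^-1` _ = set0); first exact: sigma_of0.
  by apply/seteqP; split=> w //=; rewrite /cnt big_ord0.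
have sub : Us n z `<=` Us n z.+1 by move=> s [k kz ->]; exists k => //; exact: ltnW.
have Uz : Us n z.+1 (SU n z) by exists z.
rewrite cntS; apply: sigma_ofU; apply: sigma_ofI.
- exact: sigma_of_sub (IHz S) sub.
- by apply: sigma_of_U => //; exact: measurableC.
- exact: sigma_of_sub (IHz _) sub.
- exact: sigma_of_U.
Qed.

Let cnt_law n z S : P (cnt n z @^-1` S) = P (cnt 0%N z @^-1` S).
Proof.
elim: z S => [|z IHz] S.
  by congr (P _); apply/seteqP; split=> w; rewrite /cnt /= !big_ord0.
have indep m S' D' : measurable D' -> P (cnt m z @^-1` S' `&` U m z @^-1` D') =
    (P (cnt m z @^-1` S') * P (U m z @^-1` D'))%E.
  move=> mD'; apply: (@sigma_of_indep _ _ _ _ _ _ ind (Us m z) [set SU m z]).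
  - by move=> s [k kz ->] /= [kE]; rewrite kE ltnn in kz.
  - exact: sigma_cnt.
  - exact: sigma_of_U.
have mDC : measurable (~` [set x | D x]) by exact: measurableC.
have H m : P (cnt m z.+1 @^-1` S) =
  (P (cnt m z @^-1` S) * P (U m z @^-1` (~` [set x | D x])) +
   P (cnt m z @^-1` [set a | S a.+1]) * P (U m z @^-1` [set x | D x]))%E.
  rewrite -!indep// cntS measureU//.
  - apply: (@sm setT); apply: sigma_ofI; last exact: sigma_of_U.
    by apply: (sigma_of_sub (@sigma_cnt m z _)).
  - apply: (@sm setT); apply: sigma_ofI; last exact: sigma_of_U.
    by apply: (sigma_of_sub (@sigma_cnt m z _)).
  - by rewrite -subset0 => w [[_ /= ?] [_ /=]].
by rewrite !H !IHz !prob_U.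
Qed.

Let births_sigma n m : sigma_of V [set SB n; SZ n] (births n @^-1` [set m]).
Proof.
apply: (@sigma_of_gated _ _ SZ); [|by left|by right].
exact: sigma_of_Z.
Qed.

Let count_birthsE n S : count_births n @^-1` S =
  \bigcup_m (births n @^-1` [set m] `&` cnt n m @^-1` S).
Proof.
apply/seteqP; split=> w; first by move=> Sw; exists (births n w).
by move=> [m _ [/= <-]].
Qed.

Lemma count_births_iid : pairwise_iid P count_births.
Proof.
apply: pairwise_iid_blocks => n S; rewrite !count_birthsE.
  apply: sigma_of_bigcup => m; apply: sigma_ofI.
    by apply: (sigma_of_sub (@births_sigma n m)) => s /= [->|->].
  by apply: (sigma_of_sub (@sigma_cnt n m S)) => s /= [k _ ->].
have H l : P (\bigcup_m (births l @^-1` [set m] `&` cnt l m @^-1` S)) =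
    (\sum_(0 <= m <oo) (P (births l @^-1` [set m]) * P (cnt l m @^-1` S)))%E.
  rewrite prob_bigcup.
  - apply: eq_eseriesr => m _.
    apply: (sigma_of_indep ind) (@births_sigma l m) (@sigma_cnt l m S).
    by move=> s /= [->|->] [].
  - move=> m; apply: (@sm setT); apply: sigma_ofI.
      by apply: (sigma_of_sub (@births_sigma l m)).
    by apply: (sigma_of_sub (@sigma_cnt l m S)).
  - apply/trivIsetP => i j _ _ ij; rewrite -subset0 => w [[/= -> _] [/= /eqP + _]].
    by rewrite (negbTE ij).
rewrite !H; apply: eq_eseriesr => m _; rewrite cnt_law; congr (_ * _)%E.
by apply: (@gated_law _ _ SZ) => //; exact: sigma_of_Z.
Qed.

Lemma count_births_mean :
  mean P (count_births 0%N) = ((p * delta)%:E * mean P (Z 0%N))%E.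
Proof.
have EE k : [set w | [&& B 0%N w, (k < Z 0%N w)%N & D (U 0%N k w)]] =
  [set w | B 0%N w = true] `&` (Z 0%N @^-1` [set j | (k < j)%N] `&`
    U 0%N k @^-1` [set x | D x]).
  by apply/seteqP; split=> w /=; [move=> /and3P[]|move=> [-> [-> ->]]].
apply: (@mean_scaled _ _ _ _ _ _
  (fun k w => [&& B 0%N w, (k < Z 0%N w)%N & D (U 0%N k w)])).
- exact: nat_measurable_Z.
- move=> k; rewrite EE; apply: (@sm setT); apply: sigma_ofI; first exact: sigma_of_B.
  by apply: sigma_ofI; [exact: sigma_of_Z|exact: sigma_of_U].
- move=> w; exists (Z 0%N w) => M ZM; rewrite /count_births /births /gated.
  case: (B 0%N w) => /=; last by rewrite big1// big_ord0.
  rewrite (big_ord_widen M (fun k => D (U 0%N k w) : nat) ZM) [in RHS]big_mkcond /=.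
  by apply: eq_bigr => k _; case: ifP.
- move=> k; rewrite EE (@sigma_of_indep _ _ _ _ _ _ ind [set SB 0] [set s | s != SB 0]).
  + rewrite (@sigma_of_indep _ _ _ _ _ _ ind [set SZ 0] [set SU 0 k]).
    * by rewrite prob_B prob_U// PD EFinM -muleA; congr (_ * _)%E; exact: muleC.
    * by move=> s /= ->.
    * exact: sigma_of_Z.
    * exact: sigma_of_U.
  + by move=> s /= ->; rewrite eqxx.
  + exact: sigma_of_B.
  + by apply: sigma_ofI; [exact: sigma_of_Z|exact: sigma_of_U].
Qed.

End counting.
End model.

(** * Random lists of independent points *)

Section selection.
Context {R : realType} {d : measure_display} {T : measurableType d}.
Variable P : probability T R.
Context {I : eqType}.
Variable V : I -> T -> R.
Hypothesis ind : mutually_independent P V.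
Variables (D : pred R) (nu : set R -> R).
Hypothesis mD : measurable [set x | D x].
Implicit Types (F : set I) (E : set T) (L : T -> seq R) (A : nat -> set R).

Definition list_event E L c A : set T :=
  [set w | [/\ E w, size (L w) = c & forall j, (j < c)%N -> A j (nth 0 (L w) j)]].

(* On [E] and given its length, the random list [L] is a sample of independent points with
   law [nu], and all this is decided by the variables with index in [F]. *)
Definition iid_list F E L := forall c A, (forall j, measurable (A j)) ->
  sigma_of V F (list_event E L c A) /\
  P (list_event E L c A) =
    ((\prod_(j < c) nu (A j))%:E * P (list_event E L c (fun=> setT)))%E.

Lemma iid_list_nil F : iid_list F setT (fun=> [::]).
Proof.
move=> c A mA.
have [->|c0] := posnP c.
  have H A' : list_event setT (fun=> [::]) 0 A' = setT.
    by apply/seteqP; split.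
  by rewrite !H big_ord0 mul1e; split => //; exact: sigma_ofT.
have H A' : list_event setT (fun=> [::]) c A' = set0.
  by apply/seteqP; split=> // w [_ /= c0']; rewrite -c0' in c0.
by rewrite !H measure0 mule0; split => //; exact: sigma_of0.
Qed.

Lemma iid_list_sub F F' E L : iid_list F E L -> F `<=` F' -> iid_list F' E L.
Proof.
by move=> gL FF' c A mA; have [sL ->] := gL c A mA; split=> //; exact: sigma_of_sub sL FF'.
Qed.

Lemma iid_list_eq F E L L' : iid_list F E L -> (forall w, E w -> L w = L' w) ->
  iid_list F E L'.
Proof.
move=> gL LL' c A mA.
have H A' : list_event E L' c A' = list_event E L c A'.
  by apply/seteqP; split=> w [Ew]; [rewrite -LL'//|rewrite LL'//] => sL HL.
by rewrite !H; exact: gL.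
Qed.

Lemma iid_list_setI F F' E E' L : iid_list F E L -> (forall i, F i -> ~ F' i) ->
  sigma_of V F' E' -> iid_list (F `|` F') (E `&` E') L.
Proof.
move=> gL FF' sE' c A mA.
have H A' : list_event (E `&` E') L c A' = list_event E L c A' `&` E'.
  by apply/seteqP; split=> [w [[Ew E'w] sL HL]|w [[Ew sL HL] E'w]]; split.
have [sA PA] := gL c A mA.
have [sT PT] := gL c (fun=> setT) (fun=> measurableT).
rewrite !H (sigma_of_indep ind FF' sA sE') (sigma_of_indep ind FF' sT sE') PA muleA.
split=> //; apply: sigma_ofI.
  by apply: (sigma_of_sub sA) => i; left.
by apply: (sigma_of_sub sE') => i; right.
Qed.

Lemma iid_list_bigcup F (E : nat -> set T) L : trivIset setT E ->
  (forall n, iid_list F (E n) L) -> iid_list F (\bigcup_n E n) L.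
Proof.
move=> tE gL c A mA.
have H A' : list_event (\bigcup_n E n) L c A' = \bigcup_n list_event (E n) L c A'.
  apply/seteqP; split=> w; first by move=> [[n _ Enw] sL HL]; exists n.
  by move=> [n _ [Enw sL HL]]; split=> //; exists n.
have tL A' : trivIset setT (fun n => list_event (E n) L c A').
  apply/trivIsetP => i j _ _ ij; rewrite -subset0 => w [[Ei _ _] [Ej _ _]].
  by move/trivIsetP : tE => /(_ i j Logic.I Logic.I ij); rewrite -subset0; apply; split; [exact: Ei|exact: Ej].
have sA n := (gL n c A mA).1.
have sT n := (gL n c (fun=> setT) (fun=> measurableT)).1.
rewrite !H; split; first exact: sigma_of_bigcup.
rewrite !prob_bigcup//; last 2 first.
- by move=> n; exact: sigma_of_measurable ind _ _ (sT n).
- by move=> n; exact: sigma_of_measurable ind _ _ (sA n).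
rewrite -nneseriesZl//; apply: eq_eseriesr => n _.
exact: (gL n c A mA).2.
Qed.

Lemma iid_list_rcons F E L i : iid_list F E L -> ~ F i ->
  (forall C, measurable C -> P (V i @^-1` (C `&` [set x | D x])) =
    ((nu C)%:E * P (V i @^-1` [set x | D x]))%E) ->
  iid_list (F `|` [set i]) E
    (fun w => if D (V i w) then rcons (L w) (V i w) else L w).
Proof.
move=> gL nFi nuP c A mA.
set L' := fun w => _.
have FFi j : F j -> ~ [set i] j by move=> Fj ji; apply: nFi; rewrite -ji.
pose pred_event A' := if c is c'.+1 then
  list_event E L c' A' `&` V i @^-1` (A' c' `&` [set x | D x]) else set0.
have H A' : list_event E L' c A' =
    pred_event A' `|` (list_event E L c A' `&` V i @^-1` (~` [set x | D x])).
  apply/seteqP; split=> w.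
    rewrite /list_event /L' /=; case: ifPn => Dw [Ew sL HL].
      left; move: sL HL; rewrite size_rcons /pred_event => <- HL; split.
        split=> // j js; have := HL j (ltnW js); by rewrite nth_rcons js.
      by split=> //; have := HL _ (ltnSn _); rewrite nth_rcons ltnn eqxx.
    by right; split=> //; exact/negP.
  case=> [|[[Ew sL HL] /= /negP/negbTE Dw]]; last by split=> //; rewrite /L' Dw.
  rewrite /pred_event; case: (c) => // c' [[Ew sL HL] [Aw /= Dw]].
  split=> //; rewrite /L' Dw ?size_rcons ?sL// => j; rewrite ltnS leq_eqVlt => /predU1P[->|jc].
    by rewrite nth_rcons sL ltnn eqxx.
  by rewrite nth_rcons sL jc; exact: HL.
have sigL A' c' : (forall j, measurable (A' j)) ->
    sigma_of V (F `|` [set i]) (list_event E L c' A').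
  by move=> mA'; apply: (sigma_of_sub (gL c' A' mA').1) => j; left.
have sigV C : measurable C -> sigma_of V (F `|` [set i]) (V i @^-1` C).
  by move=> mC; apply: (sigma_of_preimage (V := V)) => //; right.
have mDC : measurable (~` [set x | D x]) by exact: measurableC.
have mAD A' c' : (forall j, measurable (A' j)) -> measurable (A' c' `&` [set x | D x]).
  by move=> mA'; exact: measurableI.
have sigP A' : (forall j, measurable (A' j)) -> sigma_of V (F `|` [set i]) (pred_event A').
  move=> mA'; rewrite /pred_event; case: (c) => [|c']; first exact: sigma_of0.
  by apply: sigma_ofI; [exact: sigL|apply: sigV; exact: mAD].
have indL A' c' C : (forall j, measurable (A' j)) -> measurable C ->
    P (list_event E L c' A' `&` V i @^-1` C) =
    (P (list_event E L c' A') * P (V i @^-1` C))%E.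
  move=> mA' mC; apply: (sigma_of_indep ind FFi (gL c' A' mA').1).
  exact: (sigma_of_preimage (V := V)).
have PH A' : (forall j, measurable (A' j)) -> P (list_event E L' c A') =
    (P (pred_event A') + P (list_event E L c A' `&` V i @^-1` (~` [set x | D x])))%E.
  move=> mA'; rewrite H measureU//.
  - exact: sigma_of_measurable ind _ _ (sigP _ mA').
  - apply: sigma_of_measurable ind (F `|` [set i]) _ _.
    by apply: sigma_ofI; [exact: sigL|exact: sigV].
  - rewrite -subset0 /pred_event => w; case: (c) => [|c'] [] //.
    by move=> [_ [_ /= ?]] [_ /=].
pose AT : nat -> set R := fun=> setT.
have mT j : measurable (AT j) by exact: measurableT.
split.
  rewrite H; apply: sigma_ofU; first exact: sigP.
  by apply: sigma_ofI; [exact: sigL|exact: sigV].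
have mL A' c' : (forall j, measurable (A' j)) -> measurable (list_event E L c' A').
  by move=> mA'; exact: sigma_of_measurable ind _ _ (gL c' A' mA').1.
have mVi C : measurable C -> measurable (V i @^-1` C).
  exact: measurable_preimage ind i C.
rewrite !PH// !indL// (gL c A mA).2.
rewrite -/AT (probE P (mL _ c mT)) (probE P (mVi _ mDC)).
rewrite /pred_event; case: (c) => [|c'].
  by rewrite measure0 !add0e big_ord0 !mul1e.
rewrite !indL//; [|exact: mAD|exact: mAD].
rewrite (gL c' A mA).2 nuP// setTI (probE P (mL _ c' mT)) (probE P (mVi _ mD)).
by rewrite -!(EFinM, EFinD) big_ord_recr /=; congr EFin; ring.
Qed.

End selection.

Section uniform_law.
Context {R : realType}.
Implicit Types (f : R) (C : set R).
Local Notation mu := (@lebesgue_measure R).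

Lemma unif01E C : unif 0 1 C = mu (C `&` `[0, 1]).
Proof. by rewrite /unif subr0 invr1 mul1e. Qed.

Lemma unif_setT f : f < 1 -> unif f 1 setT = 1%E.
Proof.
move=> f1; rewrite /unif setTI lebesgue_measure_itv /= lte_fin f1.
by rewrite -EFinB -EFinM mulVf// subr_eq0 gt_eqF.
Qed.

Lemma unif01_le f : 0 <= f <= 1 -> unif 0 1 [set x | x <= f] = f%:E.
Proof.
move=> /andP[f0 f1]; rewrite unif01E (_ : _ `&` _ = `[0, f]%classic).
  rewrite lebesgue_measure_itv /= lte_fin; case: ltP => f0'.
    by rewrite -EFinB subr0.
  by congr EFin; apply/eqP; rewrite eq_le f0 f0'.
apply/seteqP; split=> x /=; rewrite !in_itv /=.
  by move=> [-> /andP[-> _]].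
by move=> /andP[-> xf]; rewrite xf (le_trans xf f1).
Qed.

Lemma unif01_gt f : 0 <= f <= 1 -> unif 0 1 [set x | f < x] = (1 - f)%:E.
Proof.
move=> /andP[f0 f1]; rewrite unif01E (_ : _ `&` _ = `]f, 1]%classic).
  rewrite lebesgue_measure_itv /= lte_fin; case: ltP => f1'.
    by rewrite -EFinB.
  by congr EFin; apply/esym/eqP; rewrite subr_eq0 eq_le f1 f1'.
apply/seteqP; split=> x /=; rewrite !in_itv /=.
  by move=> [-> /andP[_ ->]].
by move=> /andP[fx ->]; rewrite fx (le_trans f0 (ltW fx)).
Qed.

Lemma unif01_restrict f C : 0 <= f < 1 -> measurable C ->
  unif 0 1 (C `&` [set x | f < x]) = ((1 - f)%:E * unif f 1 C)%E.
Proof.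
move=> /andP[f0 f1] mC; have f10 : 1 - f != 0 by rewrite subr_eq0 gt_eqF.
rewrite /unif muleA -EFinM divff// mul1e -/(unif 0 1 _) unif01E.
rewrite (_ : _ `&` _ `&` _ = C `&` `]f, 1]); last first.
  apply/seteqP; split=> x /=; rewrite !in_itv /=.
    by move=> [[Cx fx] /andP[_ ->]]; rewrite fx.
  by move=> [Cx /andP[fx ->]]; rewrite (le_trans f0 (ltW fx)).
have -> : C `&` `[f, 1] = (C `&` [set f]) `|` (C `&` `]f, 1]).
  rewrite -setIUr; congr setI; rewrite setUC.
  apply/seteqP; split=> x /=; rewrite !in_itv /=.
    by rewrite le_eqVlt => /andP[/predU1P[->|->] ->]; [right|left].
  by move=> [/andP[/ltW -> ->//]|->]; rewrite lexx ltW.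
rewrite measureU//; last 3 first.
- exact: measurableI.
- exact: measurableI.
- by rewrite -subset0 => x [[_ /= ->] [_ /=]]; rewrite in_itv /= ltxx.
rewrite [X in (X + _)%E](_ : _ = 0%E) ?add0e//.
apply/eqP; rewrite eq_le measure_ge0 andbT -(lebesgue_measure_set1 f).
by apply: le_measure; rewrite ?inE//; exact: measurableI.
Qed.

Lemma unif_fin f C : 0 <= f < 1 -> measurable C -> unif f 1 C = (fine (unif f 1 C))%:E.
Proof.
move=> /andP[f0 f1] mC; rewrite fineK// /unif fin_numM//.
pose I1 : set R := `[f, 1]%classic.
have fin1 : (mu I1 < +oo)%E.
  by rewrite lebesgue_measure_itv /= lte_fin f1 -EFinB ltry.
rewrite ge0_fin_numE// (le_lt_trans _ fin1)//.
by apply: le_measure; rewrite ?inE /I1; [exact: measurableI|exact: measurable_itv|exact: subIsetr].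
Qed.

End uniform_law.

Section sample.
Context {R : realType} {d : measure_display} {T : measurableType d}.
Variables (P : probability T R) (B : nat -> T -> bool).
Variables (X Z : nat -> T -> nat) (U : nat -> nat -> T -> R).
Hypothesis ind : mutually_independent P (sources B X Z U).
Hypothesis lawU : forall n k, has_law P (U n k) (unif 0 1).
Variable f : R.
Hypothesis f01 : 0 <= f < 1.

Local Notation V := (sources B X Z U).
Local Notation births := (births B Z).

Fixpoint born n w : seq R :=
  if n is n'.+1 then born n' w ++ mkseq (U n' ^~ w) (births n' w) else [::].

Definition born_above n w := [seq x <- born n w | f < x].

Definition nu (A : set R) := fine (unif f 1 A).

Let mD : measurable [set x : R | f < x].
Proof.
rewrite (_ : [set x | _] = `]f, +oo[%classic); first exact: measurable_itv.
by apply/seteqP; split=> x /=; rewrite in_itv /= andbT.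
Qed.

Let nuP n k C : measurable C -> P (V (SU n k) @^-1` (C `&` [set x | f < x])) =
  ((nu C)%:E * P (V (SU n k) @^-1` [set x | (f < x)%R]))%E.
Proof.
move=> mC; have [f0 f1] := andP f01.
rewrite !(prob_U lawU)//; last exact: measurableI.
by rewrite unif01_restrict// unif01_gt ?f0 ?ltW// muleC /nu -unif_fin.
Qed.

Lemma born_above_iid_list n :
  iid_list P V nu [set s | (src_time s < n)%N] setT (born_above n).
Proof.
elim: n => [|n IHn].
  apply: iid_list_eq; first exact: iid_list_nil.
  by [].
pose E m := births n @^-1` [set m].
have -> : setT = \bigcup_m E m :> set T.
  by apply/seteqP; split=> w // _; exists (births n w).
apply: (iid_list_bigcup ind).
  apply/trivIsetP => i j _ _ ij; rewrite -subset0 => w []; rewrite /E /= => -> /eqP.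
  by rewrite (negbTE ij).
move=> m.
pose F k : set src := [set s | (src_time s < n)%N] `|` [set SB n; SZ n] `|`
  [set s | exists2 j, (j < k)%N & s = SU n j].
have step k : iid_list P V nu (F k) (E m)
    (fun w => born_above n w ++ [seq x <- mkseq (U n ^~ w) k | f < x]).
  elim: k => [|k IHk].
    apply: (@iid_list_sub _ _ _ _ _ _ _ ([set s | (src_time s < n)%N] `|` [set SB n; SZ n])).
      apply: iid_list_eq.
        rewrite -(setTI (E m)); apply: (iid_list_setI ind IHn).
          by move=> s /= sn [sE|sE]; rewrite sE /= ltnn in sn.
        apply: (sigma_of_gated true (Y := Z) (sY := SZ)); [|by left|by right].
        exact: sigma_of_Z.
      by move=> w _; rewrite cats0.
    by move=> s; left.
  apply: (@iid_list_sub _ _ _ _ _ _ _ (F k `|` [set SU n k])); last first.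
    move=> s [[Fs|[j jk ->]]|/= ->]; [by left|right|right]; last by exists k.
    by exists j => //; exact: ltnW.
  apply: iid_list_eq.
    apply: (iid_list_rcons (D := fun x => f < x) (i := SU n k) ind mD IHk); last exact: nuP.
    by case=> [[/=|[]//]|[j + [jE]]]; rewrite ?ltnn// jE ltnn.
  move=> w _; rewrite mkseqS filter_rcons /=.
  by case: ifP => // _; rewrite rcons_cat.
apply: (iid_list_sub (iid_list_eq (step m) _)).
  by move=> w /= Em; rewrite /born_above /= filter_cat Em.
by move=> s /= [[/= /ltnW//|[] ->//]|[j _ ->]//]; rewrite /= ltnS.
Qed.

Lemma born_prefix m n w : (m <= n)%N -> prefix (born m w) (born n w).
Proof.
elim: n => [|n IHn]; first by rewrite leqn0 => /eqP ->; exact: prefix_refl.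
rewrite leq_eqVlt => /predU1P[->|/IHn]; first exact: prefix_refl.
by move=> /prefix_trans; apply; rewrite /=; exact: prefix_prefix.
Qed.

Lemma born_above_prefix m n w : (m <= n)%N -> prefix (born_above m w) (born_above n w).
Proof.
move=> /born_prefix -/(_ w) /prefixP[s]; rewrite /born_above => ->.
by rewrite filter_cat prefix_prefix.
Qed.

Definition sample j w : R :=
  if pselect (exists n, (j < size (born_above n w))%N) is left H
  then nth 0 (born_above (xchoose H) w) j else 0.

Lemma sampleE n j w : (j < size (born_above n w))%N ->
  sample j w = nth 0 (born_above n w) j.
Proof.
move=> jn; rewrite /sample; case: pselect => [H|]; last by case; exists n.
have := xchooseP H; set m := xchoose H => jm.
have [mn|/ltnW nm] := leqP m n.
  by have /prefixP[s ->] := born_above_prefix w mn; rewrite nth_cat jm.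
by have /prefixP[s ->] := born_above_prefix w nm; rewrite nth_cat jn.
Qed.

Lemma mkseq_sample n w : mkseq (sample ^~ w) (size (born_above n w)) = born_above n w.
Proof.
apply: (@eq_from_nth _ 0); rewrite size_mkseq// => j js.
by rewrite nth_mkseq// (sampleE js).
Qed.

Let sm F E : sigma_of V F E -> measurable E.
Proof. exact: (sigma_of_measurable ind). Qed.

Let H m n := [set w | (m <= size (born_above n w))%N].
Let G m n (A : nat -> set R) := [set w | H m n w /\
  forall j, (j < m)%N -> A j (nth 0 (born_above n w) j)].

Let AT (m : nat) (A : nat -> set R) : nat -> set R := fun j => if (j < m)%N then A j else setT.

Let mAT m A : (forall j, measurable (A j)) -> forall j, measurable (AT m A j).
Proof. by move=> mA j; rewrite /AT; case: ifP. Qed.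

Let GE m n A : G m n A =
  \bigcup_c (if (m <= c)%N then list_event setT (born_above n) c (AT m A) else set0).
Proof.
apply/seteqP; split=> w.
  move=> [mn HA]; exists (size (born_above n w)) => //.
  rewrite mn; split=> // j jc; rewrite /AT; case: ifPn => // jm; exact: HA.
move=> [c _]; case: ifPn => // mc [_ sc HA]; split; first by rewrite /H /= sc.
move=> j jm; have := HA j (leq_trans jm mc); by rewrite /AT jm.
Qed.

Let mG m n A : (forall j, measurable (A j)) -> measurable (G m n A).
Proof.
move=> mA; rewrite GE; apply: bigcup_measurable => c _; case: ifP => // _.
exact: sm (born_above_iid_list n c (mAT m mA)).1.
Qed.

Let HE m n : H m n = G m n (fun=> setT).
Proof. by apply/seteqP; split=> w //; case. Qed.

Let nuT : nu setT = 1.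
Proof. by rewrite /nu unif_setT; case/andP: f01. Qed.

Let PG m n A : (forall j, measurable (A j)) ->
  P (G m n A) = ((\prod_(j < m) nu (A j))%:E * P (H m n))%E.
Proof.
move=> mA; rewrite HE.
have sumG A' : (forall j, measurable (A' j)) -> P (G m n A') =
  (\sum_(0 <= c <oo) ((\prod_(j < m) nu (A' j))%:E *
     P (if (m <= c)%N then list_event setT (born_above n) c (fun=> setT) else set0)))%E.
  move=> mA'; rewrite GE prob_bigcup.
  - apply: eq_eseriesr => c _; case: ifPn => mc; last by rewrite measure0 mule0.
    rewrite (born_above_iid_list n c (mAT m mA')).2; congr (_%:E * _)%E.
    rewrite (big_ord_widen c (fun j => nu (A' j)) mc) [RHS]big_mkcond /=.
    by apply: eq_bigr => j _; rewrite /AT; case: ifP.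
  - move=> c; case: ifP => // _.
    exact: sm (born_above_iid_list n c (mAT m mA')).1.
  - apply/trivIsetP => i j _ _ ij; rewrite -subset0 => w [].
    case: ifP => // _ [_ si _]; case: ifP => // _ [_ sj _].
    by move: ij; rewrite -si -sj eqxx.
rewrite sumG// nneseriesZl//; congr (_ * _)%E.
rewrite sumG//; apply: eq_eseriesr => c _.
by rewrite big1 ?mul1e.
Qed.

Lemma measurable_sample j (A : set R) : measurable A -> measurable (sample j @^-1` A).
Proof.
move=> mA; pose Aj : nat -> set R := fun k => if k == j then A else setT.
have mAj k : measurable (Aj k) by rewrite /Aj; case: ifP.
have -> : sample j @^-1` A = (\bigcup_n G j.+1 n Aj) `|`
    (~` (\bigcup_n H j.+1 n) `&` [set _ | A 0]).
  apply/seteqP; split=> w /=.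
    have [[n jn]|nn] := pselect (exists n, (j < size (born_above n w))%N).
      rewrite (sampleE jn) => Aw; left; exists n => //; split=> // k _.
      by rewrite /Aj; case: eqP => [->|].
    move=> Aw; right; split; first by move=> [n _ jn]; apply: nn; exists n.
    by move: Aw; rewrite /sample; case: pselect.
  move=> [[n _ [jn HA]]|[nn A0]].
    by rewrite (sampleE jn); have := HA j (ltnSn j); rewrite /Aj eqxx.
  rewrite /sample; case: pselect => // -[n jn]; exfalso; apply: nn; by exists n.
apply: measurableU; first by apply: bigcup_measurable => n _; exact: mG.
apply: measurableI.
  by apply: measurableC; apply: bigcup_measurable => n _; rewrite HE; exact: mG.
have [A0|A0] := pselect (A 0).
  by rewrite (_ : [set _ | _] = setT)//; apply/seteqP; split.
by rewrite (_ : [set _ | _] = set0)//; apply/seteqP; split.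
Qed.

Hypothesis born_infinite :
  {ae P, forall w, forall m, exists n, (m <= size (born_above n w))%N}.

Lemma prob_sample m (A : nat -> set R) : (forall j, measurable (A j)) ->
  P [set w | forall j, (j < m)%N -> A j (sample j w)] =
  (\prod_(j < m) nu (A j))%:E.
Proof.
move=> mA; set S := [set w | _].
have mH n : measurable (H m n) by rewrite HE; exact: mG.
have HU : P (\bigcup_n H m n) = 1%E.
  have mU : measurable (\bigcup_n H m n) by exact: bigcup_measurable.
  have : P (~` \bigcup_n H m n) = 0%E.
    apply/(negligibleP P (measurableC mU)).
    apply: negligibleS born_infinite => w /= nH inf; apply: nH.
    by have [n mn] := inf m; exists n.
  by rewrite probability_setC// (probE P mU) -EFinB => H0; have := EFin_inj H0 => H1; congr EFin; lra.
have mS : measurable S.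
  rewrite (_ : S = \bigcap_(j in [set j | (j < m)%N]) (sample j @^-1` A j)).
    by apply: bigcap_measurableType => j _; exact: measurable_sample.
  by apply/seteqP; split.
have SG n : S `&` H m n = G m n A.
  apply/seteqP; split=> w.
    by move=> [Sw Hw]; split=> // j jm; rewrite -(sampleE (leq_trans jm Hw)); exact: Sw.
  by move=> [Hw HA]; split=> // j jm; rewrite (sampleE (leq_trans jm Hw)); exact: HA.
have Hnd : {homo H m : n k / (n <= k)%N >-> (n <= k)%O}.
  move=> n k nk; apply/subsetPset => w; rewrite /H /= => /leq_trans; apply.
  by apply: size_prefix; exact: born_above_prefix.
have cvgH : P (H m n) @[n --> \oo] --> 1%E.
  rewrite -HU; apply: (@nondecreasing_cvg_mu _ _ _ P (H m)) => //.
  exact: bigcup_measurable.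
have cvgG : P (G m n A) @[n --> \oo] --> P (\bigcup_n G m n A).
  apply: (@nondecreasing_cvg_mu _ _ _ P (fun n => G m n A)) => [n||n k nk].
  - exact: mG.
  - by apply: bigcup_measurable => n _; exact: mG.
  - apply/subsetPset; rewrite -!SG; apply: setIS.
    by apply/subsetPset; exact: Hnd.
have -> : P S = P (\bigcup_n G m n A).
  have mU : measurable (\bigcup_n H m n) by exact: bigcup_measurable.
  have -> : \bigcup_n G m n A = S `&` \bigcup_n H m n.
    by rewrite setI_bigcupr; apply: eq_bigcupr => n _; rewrite SG.
  have : (P S = P (S `&` \bigcup_n H m n) + P (S `\` \bigcup_n H m n))%E.
    by rewrite addeC; exact: measureDI.
  rewrite [X in (_ + X)%E](_ : _ = 0%E) ?adde0//.
  apply/eqP; rewrite eq_le measure_ge0 andbT.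
  have <- : P (~` \bigcup_n H m n) = 0%E by rewrite probability_setC// HU subee.
  apply: le_measure; rewrite ?inE; [exact: measurableD|exact: measurableC|].
  by move=> w [].
have : P (G m n A) @[n --> \oo] --> ((\prod_(j < m) nu (A j))%:E * 1)%E.
  by under eq_fun do rewrite PG//; apply: cvgeZl => //; exact: cvgH.
by rewrite mule1 => /cvg_lim <- //; rewrite (cvg_lim _ cvgG).
Qed.

Lemma sample_law j A : measurable A -> P (sample j @^-1` A) = unif f 1 A.
Proof.
move=> mA; pose Aj : nat -> set R := fun k => if k == j then A else setT.
have mAj k : measurable (Aj k) by rewrite /Aj; case: ifP.
have -> : sample j @^-1` A = [set w | forall k, (k < j.+1)%N -> Aj k (sample k w)].
  apply/seteqP; split=> w /=; first by move=> Aw k _; rewrite /Aj; case: eqP => [->|].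
  by move=> /(_ j (ltnSn j)); rewrite /Aj eqxx.
rewrite prob_sample// big_ord_recr /= big1 ?mul1r /Aj ?eqxx; first by rewrite /nu -unif_fin.
by move=> i _; rewrite ltn_eqF// nuT.
Qed.

Lemma sample_has_law j : has_law P (sample j) (unif f 1).
Proof.
split; last exact: sample_law.
by move=> _ A mA; rewrite setTI; exact: measurable_sample.
Qed.

Lemma sample_independent : mutually_independent P sample.
Proof.
split=> [j|J A uJ mA]; first by have [] := sample_has_law j.
pose m := (\max_(j <- J) j).+1.
have Jm j : j \in J -> (j < m)%N by move=> jJ; rewrite ltnS; exact: leq_bigmax_seq.
pose A' : nat -> set R := fun k => if k \in J then A k else setT.
have mA' k : measurable (A' k) by rewrite /A'; case: ifP.
have -> : \bigcap_(i in [set` J]) (sample i @^-1` A i) =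
    [set w | forall k, (k < m)%N -> A' k (sample k w)].
  apply/seteqP; split=> w /=.
    by move=> Aw k _; rewrite /A'; case: ifPn => // kJ; exact: Aw.
  by move=> Aw j /= jJ; have := Aw j (Jm j jJ); rewrite /A' jJ.
rewrite prob_sample//= -(big_mkord xpredT (fun j => nu (A' j))).
rewrite (bigID (fun j => j \in J)) /= [X in _ * X]big1 ?mulr1; last first.
  by move=> j /negbTE jJ; rewrite /A' jJ nuT.
rewrite -big_filter.
have pJ : perm_eq [seq j <- index_iota 0 m | j \in J] J.
  apply: uniq_perm => //; first by rewrite filter_uniq// iota_uniq.
  move=> j; rewrite mem_filter mem_index_iota /=.
  by case: (boolP (j \in J)) => //= /Jm ->.
rewrite (perm_big _ pJ) /=; rewrite big_seq [RHS]big_seq; apply: eq_bigr => j jJ.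
by rewrite sample_law// /A' jJ.
Qed.

End sample.

Section distinct.
Context {R : realType} {d : measure_display} {T : measurableType d}.
Variable P : probability T R.
Context {I : eqType}.
Variable V : I -> T -> R.
Hypothesis ind : mutually_independent P V.

Lemma unif_neq_ae i j : i != j -> has_law P (V i) (unif 0 1) ->
  has_law P (V j) (unif 0 1) -> {ae P, forall w, V i w <> V j w}.
Proof.
move=> ij [mi li] [mj lj].
pose E := [set w | V i w = V j w].
have mE : measurable E.
  have -> : E = (V i \- V j) @^-1` [set 0].
    apply/seteqP; split=> w; rewrite /E /=; first by move=> ->; rewrite subrr.
    by move=> /eqP; rewrite subr_eq0 => /eqP.
  by rewrite -[X in measurable X]setTI; apply: measurable_funB => //; exact: measurable_set1.
suff PE : P E = 0%E.
  apply: (@negligibleS _ _ _ _ E); last exact/negligibleP.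
  by move=> w /= /contrapT.
have PM (m : nat) : fine (P E) <= 2 / m.+1%:R.
  pose M : R := m.+1%:R; have M0 : 0 < M by [].
  pose J (l : nat) : set R := `[l%:R / M, l.+1%:R / M]%classic.
  pose E0 := V i @^-1` (~` `[0, 1]%classic).
  pose K l := V i @^-1` J l `&` V j @^-1` J l.
  have mJ l : measurable (J l) by exact: measurable_itv.
  have mVJ k l : measurable (V k @^-1` J l) by exact: (measurable_preimage ind).
  have mK l : measurable (K l) by exact: measurableI.
  have mE0 : measurable E0.
    by apply: (measurable_preimage ind); apply: measurableC; exact: measurable_itv.
  have PE0 : P E0 = 0%E.
    rewrite li; last by apply: measurableC; exact: measurable_itv.
    by rewrite unif01E setICl measure0.
  have PJ k l : has_law P (V k) (unif 0 1) -> (P (V k @^-1` J l) <= (M^-1)%:E)%E.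
    move=> [_ lk]; rewrite lk// unif01E.
    have -> : (M^-1)%:E = lebesgue_measure (J l).
      rewrite lebesgue_measure_itv /= lte_fin ltr_pM2r ?invr_gt0// ltr_nat ltnSn.
      by rewrite -EFinB -mulrBl -natr1 addrAC subrr add0r mul1r.
    by apply: le_measure; rewrite ?inE; [apply: measurableI => //; exact: measurable_itv|exact: mJ|exact: subIsetl].
  have PK l : (P (K l) <= (M^-1 * M^-1)%:E)%E.
    rewrite (@sigma_of_indep _ _ _ _ _ _ ind [set i] [set j]).
    - by rewrite EFinM; apply: lee_pmul => //; exact: PJ.
    - by move=> k /= ->; apply/eqP.
    - exact: (sigma_of_preimage (V := V)).
    - exact: (sigma_of_preimage (V := V)).
  have sub : E `<=` E0 `|` \big[setU/set0]_(l < m.+2) K l.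
    move=> w Ew; have [?|nE0] := pselect (E0 w); [by left|right].
    move: nE0 => /contrapT /=; rewrite in_itv /= => /andP[V0 V1].
    have xM0 : 0 <= V i w * M by rewrite mulr_ge0// ltW.
    have /andP[t1 t2] := truncn_itv xM0.
    rewrite -bigcup_mkord; exists (Num.truncn (V i w * M)) => /=.
      rewrite -(ltr_nat R) (le_lt_trans t1)// (@le_lt_trans _ _ M)//.
        by rewrite ler_piMl// ltW.
      by rewrite ltr_nat.
    have Jw : J (Num.truncn (V i w * M)) (V i w).
      by rewrite /J /= in_itv /= ler_pdivrMr// t1 /= ler_pdivlMr// ltW.
    by split=> //; rewrite /= -(Ew : V i w = V j w).
  have : (P E <= \sum_(l < m.+2) (M^-1 * M^-1)%:E)%E.
    apply: (@le_trans _ _ (P E0 + P (\big[setU/set0]_(l < m.+2) K l))%E).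
      have mU : measurable (\big[setU/set0]_(l < m.+2) K l) by exact: bigsetU_measurable.
      apply: (@le_trans _ _ (P (E0 `|` \big[setU/set0]_(l < m.+2) K l))).
        by apply: le_measure; rewrite ?inE//; exact: measurableU.
      exact: measureU2.
    rewrite PE0 add0e; apply: (@le_trans _ _ (\sum_(l < m.+2) P (K l))%E).
      by apply: Boole_inequality.
    by apply: lee_sum => l _; exact: PK.
  rewrite sumEFin (probE P mE) lee_fin => /le_trans; apply.
  rewrite sumr_const card_ord -[leLHS]mulr_natl mulrA ler_pM2r ?invr_gt0//.
  by rewrite ler_pdivrMr// -natrM ler_nat; lia.
rewrite (probE P mE); congr EFin; apply/eqP; rewrite eq_le fine_ge0// andbT.
rewrite leNgt; apply/negP => r0.
set r := fine _ in r0 PM.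
have := PM (Num.bound (2 / r)); apply/negP; rewrite -ltNge ltr_pdivrMr//.
rewrite mulrC -ltr_pdivrMr// (lt_trans (archi_boundP _))//.
  by rewrite divr_ge0// ltW.
by rewrite ltr_nat.
Qed.

End distinct.

(** * Trajectories *)

Section deterministic.
Context {R : realType}.
Implicit Types (s : seq R) (f : R) (l c r : nat -> nat).

Lemma count_drop_sort s f x :
  count (fun y => (y <= f)%R) (drop x (sort <=%R s)) = (count (fun y => (y <= f)%R) s - x)%N.
Proof.
have <- : count (fun y => (y <= f)%R) (sort <=%R s) = count (fun y => (y <= f)%R) s.
  by apply/permP; rewrite perm_sort.
have : sorted <=%R (sort <=%R s) by exact: sort_le_sorted.
elim: (sort _ _) x => [|y t IHt] [|x] //= yt; first by rewrite subn0.
rewrite IHt ?(path_sorted yt)//; have [yf|fy] := leP y f => /=; first by lia.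
suff -> : count (fun y => (y <= f)%R) t = 0%N by rewrite !sub0n.
apply/eqP; rewrite -leqn0 leqNgt -has_count; apply/hasPn => z zt; rewrite -ltNge.
by rewrite (lt_le_trans fy)//; have /allP := order_path_min le_trans yt; exact.
Qed.

Lemma lindley l c r : l 0%N = 0%N -> (forall n, l n.+1 = l n + c n - r n)%N ->
  forall n, exists2 k, (k <= n)%N &
    (l n + \sum_(i < n) r i + \sum_(i < k) c i = \sum_(i < n) c i + \sum_(i < k) r i)%N.
Proof.
move=> l0 lS; elim=> [|n [k kn IHn]]; first by exists 0%N => //; rewrite l0 !big_ord0.
have recr (g : nat -> nat) : (\sum_(i < n.+1) g i = \sum_(i < n) g i + g n)%N.
  by rewrite big_ord_recr.
have [rl|rl] := leqP (r n) (l n + c n)%N.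
  exists k; [exact: leqW|rewrite lS !recr; move: IHn].
  move: (\sum_(i < n) r i)%N (\sum_(i < n) c i)%N (\sum_(i < k) r i)%N (\sum_(i < k) c i)%N.
  by lia.
by exists n.+1 => //; rewrite lS; lia.
Qed.

Lemma lindley_littleo l c r (a : R) : l 0%N = 0%N ->
  (forall n, l n.+1 = l n + c n - r n)%N ->
  (forall e : R, 0 < e -> \forall n \near \oo, `|(\sum_(i < n) c i)%N%:R - a * n%:R| <= e * n%:R) ->
  (forall e : R, 0 < e -> \forall n \near \oo, `|(\sum_(i < n) r i)%N%:R - a * n%:R| <= e * n%:R) ->
  forall e : R, 0 < e -> \forall n \near \oo, (l n)%:R <= e * n%:R.
Proof.
move=> l0 lS cvgc cvgr e e0.
have e5 : 0 < e / 5 by rewrite divr_gt0.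
have [n1 _ H1] := cvgc _ e5; have [n2 _ H2] := cvgr _ e5.
pose n0 := maxn n1 n2.
pose K := ((\sum_(i < n0) c i)%N + (\sum_(i < n0) r i)%N)%N.
pose n3 := Num.bound (K%:R / (e / 5)).
have mono (g : nat -> nat) k n : (k <= n)%N -> (\sum_(i < k) g i <= \sum_(i < n) g i)%N.
  by move=> kn; rewrite (big_ord_widen n g kn) big_mkcond; apply: leq_sum => i _; case: ifP.
exists (maxn n0 n3) => // n /= hn.
have [k kn Hk] := lindley l0 lS n.
have Kn : K%:R <= e / 5 * n%:R.
  rewrite [leRHS]mulrC -ler_pdivrMr// ltW// (lt_le_trans (archi_boundP _))//.
    by rewrite divr_ge0// ltW.
  by rewrite ler_nat; apply: leq_trans hn; rewrite /n3 leq_max leqnn orbT.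
have n0n : (n0 <= n)%N by apply: leq_trans hn; exact: leq_maxl.
have := H1 n; rewrite /= (leq_trans (leq_maxl n1 n2) n0n) ler_norml => /(_ isT) /andP[c1 c2].
have := H2 n; rewrite /= (leq_trans (leq_maxr n1 n2) n0n) ler_norml => /(_ isT) /andP[r1 r2].
have {Hk} : ((l n)%:R + (\sum_(i < n) r i)%N%:R + (\sum_(i < k) c i)%N%:R =
  (\sum_(i < n) c i)%N%:R + (\sum_(i < k) r i)%N%:R :> R) by rewrite -!natrD Hk.
move: c1 c2 r1 r2.
set cn := (\sum_(i < n) c i)%N%:R; set rn := (\sum_(i < n) r i)%N%:R.
set ck : R := (\sum_(i < k) c i)%N%:R; set rk : R := (\sum_(i < k) r i)%N%:R => c1 c2 r1 r2 Hk.
have ck0 : 0 <= ck by rewrite ler0n.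
have [kn0|n0k] := leqP k n0.
  have : rk <= K%:R by rewrite ler_nat (leq_trans (mono r _ _ kn0))// leq_addl.
  have n0R : 0 <= e / 5 * n%:R by rewrite mulr_ge0// ltW.
  have : e * n%:R = 5 * (e / 5 * n%:R) by field.
  lra.
have := H1 k; rewrite /= (leq_trans (leq_maxl n1 n2) (ltnW n0k)) ler_norml => /(_ isT) /andP[c3 c4].
have := H2 k; rewrite /= (leq_trans (leq_maxr n1 n2) (ltnW n0k)) ler_norml => /(_ isT) /andP[r3 r4].
have knR : e / 5 * k%:R <= e / 5 * n%:R by rewrite ler_wpM2l ?ler_nat// ltW.
have n0R : 0 <= e / 5 * n%:R by rewrite mulr_ge0// ltW.
have : e * n%:R = 5 * (e / 5 * n%:R) by field.
move: c3 c4 r3 r4; rewrite -/ck -/rk; lra.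
Qed.

End deterministic.

Section trajectories.
Context {R : realType} {d : measure_display} {T : measurableType d}.
Variables (B : nat -> T -> bool) (X Z : nat -> T -> nat) (U : nat -> nat -> T -> R).
Variable w : T.

Local Notation st n := (state B X Z U n w).
Local Notation born n := (born B Z U n w).
Local Notation births := (births B Z).
Local Notation demand := (removal_demand B X).

Lemma count_mkseq (a : pred R) g m : count a (mkseq g m) = (\sum_(k < m) a (g k))%N.
Proof.
elim: m => [|m IHm]; first by rewrite big_ord0.
by rewrite mkseqS -cats1 count_cat IHm /= addn0 big_ord_recr.
Qed.

Lemma count_born (a : pred R) n :
  count a (born n) = partial_sum (count_births B Z U a) n w.
Proof.
elim: n => [|n IHn]; first by rewrite /partial_sum big_ord0.
by rewrite /= count_cat IHn /partial_sum big_ord_recr /= count_mkseq.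
Qed.

Lemma count_state_step f n : count (fun y => (y <= f)%R) (st n.+1) =
  (count (fun y => (y <= f)%R) (st n) + count_births B Z U (fun y => (y <= f)%R) n w - demand n w)%N.
Proof.
rewrite /= /step /count_births /births /removal_demand /gated.
case: (B n w) => /=; first by rewrite count_cat count_mkseq subn0.
by rewrite big_ord0 addn0 count_drop_sort.
Qed.

Lemma size_state_step n : size (st n.+1) = (size (st n) + births n w - demand n w)%N.
Proof.
rewrite /= /step /births /removal_demand /gated.
case: (B n w) => /=; first by rewrite size_cat size_mkseq subn0.
by rewrite size_drop size_sort addn0.
Qed.

Lemma born_state_removed n : exists2 r, perm_eq (born n) (st n ++ r) &
  (size r <= partial_sum demand n w)%N.
Proof.
elim: n => [|n [r pr sr]]; first by exists [::].
rewrite /= /step /births /removal_demand /gated /partial_sum big_ord_recr /=.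
case Bn: (B n w) => /=.
  exists r; last by rewrite addn0.
  apply/permP => a; have /permP/(_ a) := pr; rewrite !count_cat; lia.
exists (take (X n w) (sort <=%R (st n)) ++ r).
  rewrite cats0 (perm_trans pr)// catA perm_cat2r.
  by rewrite perm_sym perm_catC cat_take_drop perm_sort.
by rewrite size_cat addnC leq_add// size_take; case: ltnP.
Qed.

Lemma card_symdiff_state f n :
  (card_symdiff (st n) [seq x <- born n | (f < x)%R] + count (fun y => (y <= f)%R) (born n) <=
   2 * count (fun y => (y <= f)%R) (st n) + partial_sum demand n w)%N.
Proof.
have [r pr sr] := born_state_removed n.
set ba := [seq x <- born n | f < x].
have p1 : (size (undup [seq x <- st n | x \notin ba]) <= count (fun y => (y <= f)%R) (st n))%N.
  rewrite -size_filter; apply: uniq_leq_size; first exact: undup_uniq.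
  move=> x; rewrite mem_undup !mem_filter negb_and -leNgt => /andP[/orP[->//|xb] xs].
  by move: xb; rewrite (perm_mem pr) mem_cat xs.
have p2 : (size (undup [seq x <- ba | x \notin st n]) <= count (fun y => (f < y)%R) r)%N.
  rewrite -size_filter; apply: uniq_leq_size; first exact: undup_uniq.
  move=> x; rewrite mem_undup !mem_filter => /andP[xs /andP[fx]].
  by rewrite (perm_mem pr) mem_cat (negbTE xs) /= => ->; rewrite fx.
have cr : (count (fun y => (y <= f)%R) r + count (fun y => (f < y)%R) r = size r)%N.
  rewrite -(count_predC (fun y => (y <= f)%R) r); congr addn.
  by apply: eq_count => y /=; rewrite ltNge.
have /permP/(_ (fun y => (y <= f)%R)) := pr; rewrite count_cat => cb.
move: p1 p2 cr cb sr; rewrite /card_symdiff.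
move: (size (undup [seq x <- st n | x \notin ba])) (size (undup [seq x <- ba | x \notin st n])).
move: (count (fun y => (y <= f)%R) (st n)) (count (fun y => (y <= f)%R) (born n)).
move: (count (fun y => (y <= f)%R) r) (count (fun y => (f < y)%R) r) (size r).
by move: (partial_sum demand n w) => *; lia.
Qed.

Lemma mem_born n x : x \in born n -> exists i k, (i < n)%N /\ x = U i k w.
Proof.
elim: n => [//|n IHn] /=; rewrite mem_cat => /orP[/IHn[i [k [ln ->]]]|/mapP[k _ ->]].
  by exists i, k; split=> //; exact: ltnW.
by exists n, k.
Qed.

Lemma uniq_born n :
  (forall i k j l, (i, k) != (j, l) -> U i k w <> U j l w) -> uniq (born n).
Proof.
move=> Uneq; elim: n => [//|n IHn] /=; rewrite cat_uniq IHn /=; apply/andP; split.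
  apply/hasPn => _ /mapP[k _ ->]; apply/negP => /mem_born[j [l [jn]]].
  by apply: Uneq; rewrite xpair_eqE gtn_eqF.
rewrite map_inj_in_uniq ?iota_uniq// => k l _ _ kl.
apply/eqP; apply: contraPT kl => kl; apply: Uneq.
by rewrite xpair_eqE eqxx.
Qed.

End trajectories.

(** * Asymptotics *)

Section asymptotics.
Context {R : realType} {d : measure_display} {T : measurableType d}.
Variables (P : probability T R) (p : R) (B : nat -> T -> bool).
Variables (X Z : nat -> T -> nat) (U : nat -> nat -> T -> R).
Hypothesis p01 : 0 < p < 1.
Hypothesis Xgt0 : forall n w, (0 < X n w)%N.
Hypothesis Zgt0 : forall n w, (0 < Z n w)%N.
Hypothesis ind : mutually_independent P (sources B X Z U).
Hypothesis PB : forall n, P [set w | B n w] = p%:E.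
Hypothesis eqX : forall n k, P [set w | X n w = k] = P [set w | X 0%N w = k].
Hypothesis eqZ : forall n k, P [set w | Z n w = k] = P [set w | Z 0%N w = k].
Hypothesis lawU : forall n k, has_law P (U n k) (unif 0 1).

Local Notation V := (sources B X Z U).
Local Notation muX := (mean P (X 0%N)).
Local Notation muZ := (mean P (Z 0%N)).
Local Notation born_above := (born_above B Z U).
Local Notation born := (born B Z U).
Local Notation demand := (removal_demand B X).
Local Notation births := (births B Z).
Local Notation counts := (count_births B Z U).
Local Notation st := (state B X Z U).

Lemma lln_ae (W : nat -> T -> nat) (a : R) : pairwise_iid P W -> mean P (W 0%N) = a%:E ->
  {ae P, forall w, forall e : R, 0 < e ->
    \forall n \near \oo, `|(partial_sum W n w)%:R - a * n%:R| <= e * n%:R}.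
Proof.
move=> iidW Wa.
have H (k : nat) : {ae P, forall w, \forall n \near \oo,
    `|(partial_sum W n w)%:R - a * n%:R| <= k.+1%:R^-1 * n%:R}.
  have k0 : 0 < (k.+1%:R^-1 : R) by rewrite invr_gt0.
  have h1 : ((a - k.+1%:R^-1)%:E < mean P (W 0%N))%E by rewrite Wa lte_fin gtrBl.
  have h2 : (mean P (W 0%N) < (a + k.+1%:R^-1)%:E)%E by rewrite Wa lte_fin ltrDl.
  apply: filterS2 (lln_ge iidW h1) (lln_le iidW h2) => w; apply: filterS2 => n.
  set x := (k.+1%:R^-1 : R) => ? ?; rewrite ler_norml; apply/andP; split; nra.
apply: filterS (ae_foralln H) => w Hw e e0.
apply: filterS (Hw (Num.bound e^-1)) => n /le_trans; apply; rewrite ler_wpM2r//.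
rewrite -[leRHS]invrK lef_pV2 ?posrE ?invr_gt0// ltW//.
by rewrite (lt_trans (archi_boundP _)) ?invr_ge0 ?ltW// ltr_nat.
Qed.

Lemma U_distinct_ae : {ae P, forall w, forall i k j l,
  (i, k) != (j, l) -> U i k w <> U j l w}.
Proof.
apply: ae_foralln => i; apply: ae_foralln => k; apply: ae_foralln => j; apply: ae_foralln => l.
have [ij|ij] := eqVneq (i, k) (j, l); first exact: aeW.
have sij : SU i k != SU j l by apply: contraNneq ij => -[-> ->].
by apply: filterS (unif_neq_ae ind sij (lawU i k) (lawU j l)) => w.
Qed.

Lemma size_born_above f n w :
  size (born_above f n w) = partial_sum (counts (fun x => f < x)) n w.
Proof. by rewrite size_filter count_born. Qed.

Lemma approaches_unif f (c : R) : 0 <= f < 1 -> 0 < c ->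
  {ae P, forall w, \forall n \near \oo, c * n%:R <= (size (born_above f n w))%:R} ->
  {ae P, forall w, forall e : R, 0 < e -> \forall n \near \oo,
    (card_symdiff (st n w) (born_above f n w))%:R <= e * (size (born_above f n w))%:R} ->
  approaches P st (unif f 1).
Proof.
move=> f01 c0 lin sym.
have large w (M : nat) : (\forall n \near \oo, c * n%:R <= (size (born_above f n w))%:R) ->
    exists n0, forall n, (n0 <= n)%N -> (M <= size (born_above f n w))%N.
  move=> [n1 _ H1]; exists (maxn n1 (Num.bound (M%:R / c))) => n; rewrite geq_max => /andP[n1n Mn].
  rewrite -(ler_nat R) (le_trans _ (H1 n n1n))// mulrC -ler_pdivrMr// ltW//.
  by rewrite (lt_le_trans (archi_boundP _)) ?ler_nat// divr_ge0// ltW.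
have inf : {ae P, forall w, forall m, exists n, (m <= size (born_above f n w))%N}.
  by apply: filterS lin => w /large H m; have [n0 /(_ n0 (leqnn _)) ?] := H m; exists n0.
exists (sample B Z U f); split; first exact: sample_independent ind lawU _ f01 inf.
split; first by move=> i; exact: sample_has_law ind lawU _ f01 inf i.
apply: filterS3 lin sym U_distinct_ae => w linw symw Uw.
exists (fun n => size (born_above f n w)).
have cardE n : card_set (mkseq (sample B Z U f ^~ w) (size (born_above f n w))) =
    size (born_above f n w).
  by rewrite mkseq_sample /card_set undup_id// filter_uniq// uniq_born.
split; first by move=> n; apply: size_prefix; exact: born_above_prefix.
split.
  by move=> M; have [n0 H0] := large w M linw; exists n0 => n /H0; rewrite cardE.
by move=> e e0; apply: filterS (symw e e0) => n; rewrite cardE mkseq_sample.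
Qed.

Let mfin (m : \bar R) : (0 <= m)%E -> (m < +oo)%E -> m = (fine m)%:E.
Proof. by move=> m0 my; rewrite fineK// ge0_fin_numE. Qed.

Let mean_ge1 (W : T -> nat) : nat_measurable W -> (forall w, 0 < W w)%N ->
  (1 <= mean P W)%E.
Proof.
move=> mW W0; rewrite -[leLHS](mean_cst P 1); apply: mean_le => //.
exact: nat_measurable_cst.
Qed.

Let measurable_le f : measurable [set x : R | x <= f].
Proof.
rewrite (_ : [set x | _] = `]-oo, f]%classic); first exact: measurable_itv.
by apply/seteqP; split=> x /=; rewrite in_itv.
Qed.

Let measurable_gt f : measurable [set x : R | f < x].
Proof.
rewrite (_ : [set x | _] = `]f, +oo[%classic); first exact: measurable_itv.
by apply/seteqP; split=> x /=; rewrite in_itv /= andbT.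
Qed.

Let demand_iid := removal_demand_iid ind PB eqX.
Let counts_iid (D : pred R) (mD : measurable [set x | D x]) :=
  count_births_iid ind PB eqZ lawU mD.

Let p0 : 0 < p. Proof. by case/andP: p01. Qed.
Let p1 : 0 < 1 - p. Proof. by rewrite subr_gt0; case/andP: p01. Qed.

Lemma approaches_infinite_mean : muZ = +oo%E -> (muX < +oo)%E ->
  approaches P st (unif 0 1).
Proof.
move=> muZy muXy.
have f01 : 0 <= (0 : R) < 1 by rewrite lexx ltr01.
have f01' : 0 <= (0 : R) <= 1 by rewrite lexx ler01.
pose mX := fine muX.
have muXE : muX = mX%:E by exact: mfin (mean_ge0 _ _) muXy.
have linK (K : R) : {ae P, forall w, \forall n \near \oo,
    K * n%:R <= (size (born_above 0 n w))%:R}.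
  have : (K%:E < mean P (counts (fun x => 0 < x)%R 0%N))%E.
    rewrite (count_births_mean ind PB lawU (measurable_gt 0) (unif01_gt f01')).
    by rewrite subr0 mulr1 muZy gt0_muley ?ltry// lte_fin.
  move=> /(lln_ge (counts_iid (measurable_gt 0))).
  by apply: filterS => w; apply: filterS => n; rewrite size_born_above.
pose K1 := (1 - p) * mX + 1.
have demK : {ae P, forall w, \forall n \near \oo, (partial_sum demand n w)%:R <= K1 * n%:R}.
  apply: lln_le => //.
  by rewrite (removal_demand_mean ind PB) muXE -EFinM lte_fin ltrDl.
have cntK : {ae P, forall w, \forall n \near \oo,
    (partial_sum (counts (fun x => x <= 0)%R) n w)%:R <= 1 * n%:R :> R}.
  apply: lln_le; first exact: counts_iid.
  rewrite (count_births_mean ind PB lawU (measurable_le 0) (unif01_le f01')).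
  by rewrite mulr0 mul0e lte_fin.
apply: (@approaches_unif 0 1 f01 ltr01); first exact: linK.
have K10 : 0 < K1 + 1.
  have : 0 <= (1 - p) * mX by rewrite mulr_ge0 ?(ltW p1)// fine_ge0// mean_ge0.
  by rewrite /K1; lra.
apply: filterS3 (ae_foralln (fun k : nat => linK k%:R)) demK cntK => w linw demw cntw e e0.
have := linw (Num.bound ((K1 + 1) / e)).
move: demw cntw; apply: filterS3 => n hd hc hl.
have := card_symdiff_state B X Z U w 0 n; rewrite count_born -/(born_above 0 n w).
have [r pr _] := born_state_removed B X Z U w n.
have /permP/(_ (fun y => (y <= 0)%R)) := pr; rewrite count_cat count_born => cb.
move=> hs.
have : (card_symdiff (st n w) (born_above 0 n w))%:R <=
    ((partial_sum demand n w + partial_sum (counts (fun y => (y <= 0)%R)) n w)%N)%:R :> R.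
  rewrite ler_nat; move: hs cb.
  move: (card_symdiff _ _) (partial_sum _ n w) (partial_sum _ n w) (count _ _) (count _ _).
  by move=> ? ? ? ? ? *; lia.
rewrite natrD => /le_trans; apply.
apply: (@le_trans _ _ ((K1 + 1) * n%:R)); first by rewrite mulrDl lerD.
apply: (@le_trans _ _ (e * ((Num.bound ((K1 + 1) / e))%:R * n%:R))); last first.
  by rewrite ler_wpM2l// ltW.
rewrite mulrA ler_wpM2r// mulrC -ler_pdivrMr// ltW// archi_boundP//.
by rewrite divr_ge0// ltW.
Qed.

Lemma approaches_supercritical : (muZ < +oo)%E -> (muX < +oo)%E ->
  fine muX / (fine muX + fine muZ) < p ->
  approaches P st (unif ((1 - p) / p * (fine muX / fine muZ)) 1).
Proof.
move=> muZy muXy; set mX := fine muX; set mZ := fine muZ => pcp.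
have muXE : muX = mX%:E by exact: mfin (mean_ge0 _ _) muXy.
have muZE : muZ = mZ%:E by exact: mfin (mean_ge0 _ _) muZy.
have mX1 : 1 <= mX by rewrite -lee_fin -muXE; apply: mean_ge1 => //; exact: nat_measurable_X ind 0%N.
have mZ1 : 1 <= mZ by rewrite -lee_fin -muZE; apply: mean_ge1 => //; exact: nat_measurable_Z ind 0%N.
have mX0 : 0 < mX by rewrite (lt_le_trans ltr01).
have mZ0 : 0 < mZ by rewrite (lt_le_trans ltr01).
set f := (1 - p) / p * (mX / mZ).
pose a := (1 - p) * mX.
have fa : p * f * mZ = a by rewrite /f /a; field; rewrite !gt_eqF.
have apZ : a < p * mZ.
  by move: pcp; rewrite ltr_pdivrMr ?addr_gt0// /a; lra.
have f0 : 0 <= f by rewrite mulr_ge0// divr_ge0// ltW.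
have f1 : f < 1.
  by rewrite -(@ltr_pM2l _ (p * mZ)) ?mulr_gt0// mulr1 mulrAC fa.
have f01 : 0 <= f < 1 by rewrite f0.
have f01' : 0 <= f <= 1 by rewrite f0 ltW.
pose g := p * (1 - f) * mZ.
have g0 : 0 < g by rewrite !mulr_gt0// subr_gt0.
have lin : {ae P, forall w, \forall n \near \oo,
    g / 2 * n%:R <= (size (born_above f n w))%:R}.
  have : ((g / 2)%:E < mean P (counts (fun x => f < x)%R 0%N))%E.
    rewrite (count_births_mean ind PB lawU (measurable_gt f) (unif01_gt f01')).
    by rewrite muZE -EFinM lte_fin -/g; lra.
  move=> /(lln_ge (counts_iid (measurable_gt f))).
  by apply: filterS => w; apply: filterS => n; rewrite size_born_above.
apply: (@approaches_unif f (g / 2) f01) => //; first by rewrite divr_gt0.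
have demA : {ae P, forall w, forall e : R, 0 < e -> \forall n \near \oo,
    `|(partial_sum demand n w)%:R - a * n%:R| <= e * n%:R}.
  by apply: lln_ae => //; rewrite (removal_demand_mean ind PB) muXE -EFinM.
have cntA : {ae P, forall w, forall e : R, 0 < e -> \forall n \near \oo,
    `|(partial_sum (counts (fun x => (x <= f)%R)) n w)%:R - a * n%:R| <= e * n%:R}.
  apply: lln_ae; first exact: counts_iid.
  rewrite (count_births_mean ind PB lawU (measurable_le f) (unif01_le f01')).
  by rewrite muZE -EFinM fa.
apply: filterS3 lin demA cntA => w linw demw cntw e e0.
pose e' := e * (g / 2) / 4.
have e'0 : 0 < e' by rewrite divr_gt0// mulr_gt0// divr_gt0.
have low := @lindley_littleo R (fun n => count (fun y => (y <= f)%R) (st n w))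
  (fun n => counts (fun x => (x <= f)%R) n w) (fun n => demand n w) a (erefl _)
  (count_state_step B X Z U w f) cntw demw e' e'0.
near=> n.
have h1 : g / 2 * n%:R <= (size (born_above f n w))%:R by near: n.
have h2 : `|(partial_sum demand n w)%:R - a * n%:R| <= e' * n%:R by near: n; exact: demw.
have h3 : `|(partial_sum (counts (fun x => (x <= f)%R)) n w)%:R - a * n%:R| <= e' * n%:R.
  by near: n; exact: cntw.
have h4 : (count (fun y => (y <= f)%R) (st n w))%:R <= e' * n%:R by near: n.
have := card_symdiff_state B X Z U w f n; rewrite count_born -/(born_above f n w).
rewrite -(ler_nat R) [leLHS]natrD [leRHS]natrD natrM => hs.
apply: (@le_trans _ _ (e * (g / 2 * n%:R))); last by rewrite ler_wpM2l// ltW.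
have -> : e * (g / 2 * n%:R) = 4 * (e' * n%:R) by rewrite /e'; field.
move: h2 h3; rewrite !ler_norml => /andP[_ h2] /andP[h3 _].
by move: hs h2 h3 h4; lra.
Unshelve. all: by end_near. Qed.

Lemma infinitely_often_empty w (K K' : R) : K < K' ->
  (\forall n \near \oo, (partial_sum births n w)%:R <= K * n%:R) ->
  (\forall n \near \oo, K' * n%:R <= (partial_sum demand n w)%:R) ->
  forall m, exists n, (m <= n)%N /\ st n w = [::].
Proof.
move=> KK' [n1 _ H1] [n2 _ H2] m; apply: contrapT => ne.
have pos n : (m <= n)%N -> (0 < size (st n w))%N.
  by move=> mn; rewrite lt0n; apply/eqP => /size0nil s0; apply: ne; exists n.
have walk j : (size (st (m + j) w) + partial_sum demand (m + j) w + partial_sum births m w =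
    size (st m w) + partial_sum births (m + j) w + partial_sum demand m w)%N.
  elim: j => [|j IHj]; first by rewrite addn0; lia.
  have := pos (m + j.+1)%N (leq_addr _ _).
  have recr (W : nat -> T -> nat) n : partial_sum W n.+1 w = (partial_sum W n w + W n w)%N.
    by rewrite /partial_sum big_ord_recr.
  rewrite addnS size_state_step !recr; move: IHj.
  move: (size _) (size _) (partial_sum _ _ _) (partial_sum _ _ _) (partial_sum _ _ _) (partial_sum _ _ _) (births _ _) (demand _ _).
  by move=> *; lia.
pose C := (size (st m w) + partial_sum demand m w)%N.
pose N := (m + (n1 + (n2 + (Num.bound (C%:R / (K' - K))).+1)))%N.
have h1 : (partial_sum births N w)%:R <= K * N%:R by apply: H1; rewrite /= /N; lia.
have h2 : K' * N%:R <= (partial_sum demand N w)%:R by apply: H2; rewrite /= /N; lia.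
have h3 : (partial_sum demand N w)%:R <= C%:R + (partial_sum births N w)%:R :> R.
  have mN : (m + (N - m))%N = N by rewrite subnKC// leq_addr.
  rewrite -natrD ler_nat; have := walk (N - m)%N; rewrite mN /C => hw.
  by rewrite addnAC -hw -addnA addnCA leq_addr.
have : C%:R < (K' - K) * N%:R.
  rewrite mulrC -ltr_pdivrMr ?subr_gt0// (lt_trans (archi_boundP _))//.
    by rewrite divr_ge0// subr_ge0 ltW.
  rewrite ltr_nat /N; move: (Num.bound _) => b.
  by rewrite !addnA addnS ltnS leq_addl.
by rewrite mulrBl; lra.
Qed.

Lemma subcritical_empty : (muZ < +oo)%E ->
  ((muX < +oo)%E /\ p < fine muX / (fine muX + fine muZ)) \/ muX = +oo%E ->
  {ae P, forall w, forall m, exists n, (m <= n)%N /\ st n w = [::]}.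
Proof.
move=> muZy; set mX := fine muX; set mZ := fine muZ => cond.
have muZE : muZ = mZ%:E by exact: mfin (mean_ge0 _ _) muZy.
have mZ1 : 1 <= mZ by rewrite -lee_fin -muZE; apply: mean_ge1 => //; exact: nat_measurable_Z ind 0%N.
have [K' [KK' K'X]] : exists K' : R, p * mZ < K' /\ (K'%:E < (1 - p)%:E * muX)%E.
  case: cond => [[muXy pc]|->].
    have muXE : muX = mX%:E by exact: mfin (mean_ge0 _ _) muXy.
    have mX0 : 0 <= mX by rewrite fine_ge0// mean_ge0.
    have : p * mZ < (1 - p) * mX.
      by move: pc; rewrite ltr_pdivlMr; lra.
    rewrite muXE -EFinM => h; exists ((p * mZ + (1 - p) * mX) / 2).
    by rewrite lte_fin; split; lra.
  exists (p * mZ + 1); split; first by rewrite ltrDl.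
  by rewrite gt0_muley ?ltry// lte_fin.
pose K := (p * mZ + K') / 2.
have birthsK : {ae P, forall w, \forall n \near \oo, (partial_sum births n w)%:R <= K * n%:R}.
  apply: lln_le; first exact: births_iid ind PB eqZ.
  by rewrite (births_mean ind PB) muZE -EFinM lte_fin /K; lra.
have demandK : {ae P, forall w, \forall n \near \oo, K' * n%:R <= (partial_sum demand n w)%:R}.
  by apply: lln_ge => //; rewrite (removal_demand_mean ind PB).
apply: filterS2 birthsK demandK => w; apply: infinitely_often_empty.
by rewrite /K; lra.
Qed.

End asymptotics.

Unset Implicit Arguments.

Theorem theorem4 (R : realType) (d : measure_display) (T : measurableType d)
  (P : probability T R) (p : R) (B : nat -> T -> bool)
  (X Z : nat -> T -> nat) (U : nat -> nat -> T -> R) :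
  0 < p < 1 ->
  (forall n w, (0 < X n w)%N) ->
  (forall n w, (0 < Z n w)%N) ->
  mutually_independent P (sources B X Z U) ->
  (forall n, P [set w | B n w] = p%:E) ->
  (forall n k, P [set w | X n w = k] = P [set w | X 0%N w = k]) ->
  (forall n k, P [set w | Z n w = k] = P [set w | Z 0%N w = k]) ->
  (forall n k, has_law P (U n k) (unif 0 1)) ->
  let muX := mean P (X 0%N) in
  let muZ := mean P (Z 0%N) in
  let pc := fine muX / (fine muX + fine muZ) in
  (* (a) *)
  (muZ = +oo%E -> (muX < +oo)%E ->
     approaches P (state B X Z U) (unif 0 1)) /\
  (* (b) *)
  ((muZ < +oo)%E -> (muX < +oo)%E -> pc < p ->
     approaches P (state B X Z U)
       (unif ((1 - p) / p * (fine muX / fine muZ)) 1)) /\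
  (* (c) *)
  ((muZ < +oo)%E -> (((muX < +oo)%E /\ p < pc) \/ muX = +oo%E) ->
     {ae P, forall w, forall m, exists n, (m <= n)%N /\ state B X Z U n w = [::]}).
Proof.
move=> p01 X0 Z0 ind PB eqX eqZ lawU muX muZ pc; split; [|split].
- exact: (approaches_infinite_mean p01 ind PB eqX eqZ lawU).
- exact: (approaches_supercritical p01 X0 Z0 ind PB eqX eqZ lawU).
- exact: (subcritical_empty p01 Z0 ind PB eqX eqZ).
Qed.
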